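(* With $u_2=-4K^2$ and $t_3,t_4,t_5$ the polynomials in $r^2,u_2,\sigma_1,\dots,\sigma_5$ defined in the context, $$\alpha'_5=\tfrac14\,\mathrm{Res}(t_3^2-4u_2t_4,\;t_5,\;r^2),$$ where $\mathrm{Res}(\cdot,\cdot,r^2)$ is the resultant with respect to $r^2$, and $\alpha'_5$ is regarded as a polynomial in $u_2$ (with $16K^2=-4u_2$) and $\sigma_1,\dots,\sigma_5$.
   Context: An $(n+1)$-gon is semicyclic if it is inscribed in a circle and one of its sides is a diameter of that circle (polygons are oriented and may be non-convex and self-intersecting; the area $K$ is the signed area $\oint x\,dy$). For $n\ge2$, $\alpha'_n$ is the unique irreducible polynomial with integer coefficients in $n+1$ variables, monic in the first variable, homogeneous when the first variable has degree $2$ and the others degree $1$, such that $\alpha'_n(16K^2,a_1^2,\dots,a_n^2)=0$ whenever $a_1,\dots,a_n$ are the lengths of the sides, excluding a diameter, of a semicyclic $(n+1)$-gon of area $K$. It is symmetric in the last $n$ variables, hence a polynomial in $16K^2$ and the elementary symmetric functions $\sigma_1,\dots,\sigma_n$ of $a_1^2,\dots,a_n^2$. Regarding $r^2,u_2,\sigma_1,\dots,\sigma_5$ as indeterminates, define \begin{align*} t_1&=\sigma_1-4r^2,\\ t_2&=-\sigma_2+\tfrac14t_1^2+4r^2t_1-u_2,\\ t_3&=\sigma_3+\tfrac12t_1t_2-r^2(t_1^2-4t_2),\\ t_4&=-\sigma_4+\tfrac14t_2^2-2r^2t_1t_2,\\ t_5&=\sigma_5-r^2t_2^2. \end{align*}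 *)

(* Defs.v *)
From HB Require Import structures.
From mathcomp Require Import all_boot all_order all_algebra.
From mathcomp Require Import boolp classical_sets reals.
From mathcomp Require Import mpoly.

Set Implicit Arguments.
Unset Strict Implicit.
Unset Printing Implicit Defensive.

Import Order.TTheory GRing.Theory Num.Theory.
Local Open Scope ring_scope.

(** ** Semicyclic polygons *)

(* An (n+1)-gon is the cyclic sequence of its vertices; side i joins v i to
   v (ordS i).  Nothing forbids non-convexity, self-intersections or repeated
   vertices. *)
Section Polygons.
Variables (R : realType) (n : nat).
Implicit Types (v : 'I_n.+1 -> R * R) (p q c : R * R).

Definition dist p q : R := Num.sqrt ((p.1 - q.1) ^+ 2 + (p.2 - q.2) ^+ 2).

Definition side_length v (i : 'I_n.+1) : R := dist (v i) (v (ordS i)).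

(* The line integral of x dy along the segment from p to q is
   (p.1 + q.1) / 2 * (q.2 - p.2). *)
Definition signed_area v : R :=
  \sum_(i < n.+1)
    ((v i).1 + (v (ordS i)).1) / 2 * ((v (ordS i)).2 - (v i).2).

(* All vertices lie on a circle with centre c and radius r, and side j is a
   diameter of it, i.e. c is the midpoint of side j. *)
Definition semicyclic v (j : 'I_n.+1) : Prop :=
  exists c : R * R, exists r : R,
    [/\ 0 < r, forall i, dist (v i) c = r & v j + v (ordS j) = c *+ 2].

End Polygons.

(** ** The polynomial alpha'_n *)

(* In {mpoly int[n.+1]} the first variable 'X_ord0 stands for 16 K^2 and
   'X_(lift ord0 i), for i : 'I_n, for the squared side lengths. *)

Definition irreducible_elt (A : idomainType) (a : A) : Prop :=
  [/\ a != 0, a \isn't a GRing.unit &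
      forall b c, a = b * c -> b \is a GRing.unit \/ c \is a GRing.unit].

(* P as a univariate polynomial in its first variable. *)
Definition in_first (n : nat) (P : {mpoly int[n.+1]}) : {poly {mpoly int[n]}} :=
  mmap (fun z : int => (z%:MP)%:P)
       (fun i => if unlift ord0 i is Some j then ('X_j)%:P else 'X) P.

Definition weighted_homog (n : nat) (P : {mpoly int[n.+1]}) : Prop :=
  exists d : nat, forall m, m \in msupp P ->
    (2 * m ord0 + \sum_(i < n) m (lift ord0 i))%N = d.

(* The sides other than the diameter j are enumerated by lift j. *)
Definition vanishes_on_semicyclic (R : realType) (n : nat)
    (P : {mpoly int[n.+1]}) : Prop :=
  forall (v : 'I_n.+1 -> R * R) (j : 'I_n.+1), semicyclic v j ->
    mmap (intr : int -> R)
      (fun i => if unlift ord0 i is Some k then side_length v (lift j k) ^+ 2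
                else 16 * signed_area v ^+ 2) P = 0.

Definition is_alpha' (R : realType) (n : nat) (P : {mpoly int[n.+1]}) : Prop :=
  [/\ irreducible_elt P, in_first P \is monic, weighted_homog P
    & vanishes_on_semicyclic R P].

(* Definite description: alpha' R n is the P with is_alpha' R P if there is
   exactly one such P, and 0 (which does not satisfy is_alpha') otherwise. *)
Definition alpha' (R : realType) (n : nat) : {mpoly int[n.+1]} :=
  xget 0 [set P | unique (@is_alpha' R n) P]%classic.

(** ** Change of variables *)

(* P(-4 u_2, x_1, ..., x_n), with 'X_ord0 now standing for u_2. *)
Definition subst_u2 (n : nat) (P : {mpoly int[n.+1]}) : {mpoly rat[n.+1]} :=
  map_mpoly (intr : int -> rat) P \mPo
    [tuple if i == ord0 then - 4 *: 'X_ord0 else 'X_i | i < n.+1].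

(* In the argument A the variable 'X_ord0 stands for u_2 and
   'X_(lift ord0 k) for sigma_(k+1); the result is A with each sigma_k replaced
   by the k-th elementary symmetric polynomial in x_1, ..., x_n.  The map
   is injective since these are algebraically independent. *)
Definition subst_sigma (n : nat) (A : {mpoly rat[n.+1]}) : {mpoly rat[n.+1]} :=
  A \mPo
    [tuple if unlift ord0 i is Some k
           then mesym n rat k.+1 \mPo [tuple 'X_(lift ord0 l) | l < n]
           else 'X_ord0 | i < n.+1].

(** ** The polynomials t_1, ..., t_5 *)

(* Elements of Q[u_2, sigma_1, ..., sigma_5][r^2], the indeterminate of the
   outer polynomial ring being r^2 itself. *)
Definition Qsig := {mpoly rat[6]}.

Definition r2 : {poly Qsig} := 'X.
Definition u2 : {poly Qsig} := ('X_ord0 : Qsig)%:P.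
Definition sigma (k : nat) : {poly Qsig} := ('X_(inord k) : Qsig)%:P.

(* The divisions by 2 and 4 below are by units of {poly Qsig}. *)
Fact unit_nat (k : nat) : (k.+1%:R : {poly Qsig}) \is a GRing.unit.
Proof.
have -> : k.+1%:R = ((k.+1%:R : rat)%:MP : Qsig)%:P :> {poly Qsig}.
  by rewrite !rmorph_nat.
by apply/rmorph_unit/rmorph_unit; rewrite unitfE pnatr_eq0.
Qed.

Definition t1 : {poly Qsig} := sigma 1 - 4 * r2.
Definition t2 : {poly Qsig} := - sigma 2 + t1 ^+ 2 / 4 + 4 * r2 * t1 - u2.
Definition t3 : {poly Qsig} :=
  sigma 3 + t1 * t2 / 2 - r2 * (t1 ^+ 2 - 4 * t2).
Definition t4 : {poly Qsig} := - sigma 4 + t2 ^+ 2 / 4 - 2 * r2 * t1 * t2.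
Definition t5 : {poly Qsig} := sigma 5 - r2 * t2 ^+ 2.

(* Main.v *)
(* Put D = 4 r^2, x_0 = 16 K^2 and let A, B be 64 (t_3^2 - 4 u_2 t_4) and 64 t_5
   as polynomials in D, so that the right-hand side becomes Res_D(A, B) / 256.

   Integrality: modulo B one has D A = 4 C with C = D G + 16 H, and
   Res_D(D, B) = - 64 sigma_5, whence sigma_5 Res_D(A, B) is divisible by 256.
   The quotient P is weighted homogeneous of weight 30, and its coefficient of
   x_0^15 is found by putting all sigma_k = 0.

   Vanishing: the quotients q_i of consecutive vertices, seen as complex numbers
   from the centre, have product -1 over the five sides other than the diameter.
   The squared sides are r^2 (2 - q_i - 1/q_i) and x_0 is
   - r^4 (sum (q_i - 1/q_i))^2, so A and B vanish at D = 4 r^2 by identities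
   between the elementary symmetric functions of the q_i.

   Irreducibility: at the squared sides (1, 2, 4, 7, 9) the polynomial P becomes
   irreducible of degree 15 modulo 11.

   Uniqueness: if Q also vanishes on all semicyclic hexagons, divide it by P with
   remainder T in x_0.  If T <> 0, then g = Res_{x_0}(P, T) vanishes at all
   squared side lengths of hexagons.  Four of the sides can be prescribed while
   the fifth is unbounded, so g vanishes at all positive integers.  But for
   integers congruent to (1, 2, 4, 7, 9) modulo 11 the polynomial P is
   irreducible over the rationals and cannot have a common root with T. *)

Require Import Defs.
From Stdlib Require Import ZArith.
From HB Require Import structures.
From mathcomp Require Import all_boot all_order all_algebra all_field.
From mathcomp Require Import boolp classical_sets reals.
From mathcomp Require Import mpoly.
From mathcomp Require Import complex polyrcf.
From mathcomp Require Import ring lra zify ssrZ.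
Import ssrZ.Instances.

Set Implicit Arguments.
Unset Strict Implicit.
Unset Printing Implicit Defensive.

Import Order.TTheory GRing.Theory Num.Theory.
Local Open Scope ring_scope.

(** * Resultants with prescribed formal degrees *)

Section SylvesterDet.
Variable R : comNzRingType.
Implicit Types (p q h : {poly R}) (m n : nat).

(** Truncated subtraction makes [j - k] zero when [j < k], hence the factor [*+ (k <= j)]. *)
Definition syl m n p q : 'M[R]_(n + m) :=
  \matrix_(i, j) match split i with
                 | inl k => p`_(j - k) *+ (k <= j)
                 | inr k => q`_(j - k) *+ (k <= j)
                 end.

(* The resultant of p and q seen as polynomials of formal degrees m and n, so
   that no condition on leading coefficients is needed under morphisms. *)
Definition sres m n p q : R := \det (syl m n p q).

Lemma resultant_sres m n p q :
  size p = m.+1 -> size q = n.+1 -> resultant p q = sres m n p q.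
Proof.
move=> sp sq; have -> : resultant p q = sres (size p).-1 (size q).-1 p q.
  by congr (\det _); apply/matrixP=> i j; rewrite Sylvester_mxE [RHS]mxE.
by rewrite sp sq.
Qed.

(** As a polynomial in X, the determinant of [S + X T] has constant term [\det S], and its value at
    [c] differs from that term by a multiple of [c]. *)
Lemma det_lerp (n : nat) (S T : 'M[R]_n) (c : R) :
  exists k, \det (S + c *: T) = \det S + c * k.
Proof.
pose M : 'M[{poly R}]_n := map_mx polyC S + 'X *: map_mx polyC T.
have ev x : (\det M).[x] = \det (S + x *: T).
  rewrite -horner_evalE -det_map_mx; congr (\det _); apply/matrixP=> i j.
  by rewrite !mxE /= /horner_eval !hornerE.
move: (ev c) (ev 0); rewrite scale0r addr0 => <- <-.
elim/poly_ind: (\det M) => [|p b _]; first by exists 0; rewrite !hornerE.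
by exists p.[c]; rewrite !hornerE mulrC addrC.
Qed.

Lemma sres_cong m n p h q (c : R) :
  exists k, sres m n (p + c *: h) q = sres m n p q + c * k.
Proof.
have -> : sres m n (p + c *: h) q = \det (syl m n p q + c *: syl m n h 0).
  congr (\det _); apply/matrixP=> i j; rewrite !mxE; case: split => k.
    by rewrite coefD coefZ mulrnDl mulrnAr.
  by rewrite coef0 mul0rn mulr0 addr0.
exact: det_lerp.
Qed.

Lemma prod_expr_ord (c : R) m n :
  \prod_(i < n + m) c ^+ i =
  (\prod_(i < n) c ^+ i) * (\prod_(i < m) c ^+ i) * c ^+ (m * n).
Proof.
rewrite big_split_ord -mulrA mulnC exprM /=; congr (_ * _).
have -> : (c ^+ n) ^+ m = \prod_(i < m) c ^+ n by rewrite prodr_const card_ord.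
by rewrite -big_split; apply: eq_bigr => i _; rewrite exprD mulrC.
Qed.

(** Multiplying row k of each band by [c ^+ k] turns the substitution into multiplication of column
    j by [c ^+ j]. The factor [w] stays on both sides because [c] need not be cancellable. *)
Lemma sres_scale_eq m n p q (a b c : R) :
  let w := (\prod_(i < n) c ^+ i) * (\prod_(i < m) c ^+ i) in
  w * sres m n (a *: (p \Po (c *: 'X))) (b *: (q \Po (c *: 'X)))
  = w * (a ^+ n * b ^+ m * c ^+ (m * n) * sres m n p q).
Proof.
move=> w.
have coefS (r : {poly R}) k : (r \Po (c *: 'X))`_k = c ^+ k * r`_k.
  rewrite comp_polyE coef_sum.
  under eq_bigr => i _ do rewrite coefZ exprZn coefZ coefXn.
  have [lt|ge] := ltnP k (size r); last first.
    rewrite [r`_k]nth_default // mulr0 big1 // => i _.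
    by rewrite gtn_eqF ?mulr0 // (leq_trans (ltn_ord i)).
  rewrite (bigD1 (Ordinal lt)) //= eqxx mulr1 mulrC big1 ?addr0 // => i.
  by rewrite -val_eqE eq_sym /= => /negbTE->; rewrite !mulr0.
pose d1 := row_mx (\row_(i < n) c ^+ i) (\row_(i < m) c ^+ i) : 'rV[R]_(n + m).
pose d2 := row_mx (const_mx a : 'rV[R]_n) (const_mx b : 'rV[R]_m).
pose d3 := \row_(i < n + m) c ^+ i.
have prodrow (u : 'rV[R]_n) (v : 'rV[R]_m) :
    \det (diag_mx (row_mx u v)) = (\prod_i u 0 i) * \prod_i v 0 i.
  rewrite det_diag big_split_ord; congr (_ * _); apply: eq_bigr => i _.
    by rewrite row_mxEl.
  by rewrite row_mxEr.
have H : diag_mx d1 *m syl m n (a *: (p \Po (c *: 'X))) (b *: (q \Po (c *: 'X)))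
         = diag_mx d2 *m syl m n p q *m diag_mx d3.
  apply/matrixP=> i j; rewrite mul_mx_diag !mul_diag_mx !mxE.
  case: splitP => k ik; rewrite !mxE coefZ coefS; case: leqP => kj;
    rewrite ?mulr0n ?mulr0 ?mul0r //= !mulr1n.
    by rewrite -[X in _ * c ^+ X](subnKC kj) exprD; set u := p`_ _; ring.
  by rewrite -[X in _ * c ^+ X](subnKC kj) exprD; set u := q`_ _; ring.
have := congr1 determinant H; rewrite !det_mulmx !prodrow det_diag.
under eq_bigr do rewrite mxE.
under [X in _ * X * _ = _]eq_bigr do rewrite mxE.
under [X in _ = X * _ * _ * _]eq_bigr do rewrite mxE.
under [X in _ = _ * X * _ * _]eq_bigr do rewrite mxE.
under [X in _ = _ * X]eq_bigr do rewrite mxE.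
rewrite prod_expr_ord !prodr_const !card_ord -/w => ->.
by rewrite -/(sres _ _ _ _); ring.
Qed.

Lemma sresZ m n p q (a b : R) :
  sres m n (a *: p) (b *: q) = a ^+ n * b ^+ m * sres m n p q.
Proof.
have := @sres_scale_eq m n p q a b 1.
rewrite scale1r !comp_polyXr expr1n mulr1.
have one k : \prod_(i < k) 1 ^+ i = 1 :> R by rewrite big1 // => i _; rewrite expr1n.
by rewrite /= !one !mul1r.
Qed.

(** The only entry of the first column that can be nonzero is the constant coefficient of [q] in the
    last row, and the complementary minor is the identity matrix. *)
Lemma sresX n q : size q = n.+1 -> sres 1 n 'X q = (-1) ^+ n * q`_0.
Proof.
move=> sq; rewrite /sres.
have j0 : (0 < n + 1)%N by rewrite addn1.
pose c0 : 'I_(n + 1) := Ordinal j0.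
rewrite (expand_det_col _ c0) (bigD1 (rshift n (ord0 : 'I_1))) //= big1 => [|i ni].
  rewrite addr0 mxE (unsplitK (inr _)) /= mulr1n mulrC /cofactor /= !addn0.
  congr (_ * _); set M := row' _ _; suff -> : M = 1%:M by rewrite det1 mulr1.
  apply/matrixP => i j; rewrite !mxE.
  have ltn k : (k < (n + 1).-1 -> k < n)%N by rewrite addn1.
  have li : lift (rshift n (ord0 : 'I_1)) i = i :> nat.
    by rewrite /= /bump addn0 leqNgt ltn.
  have lj : lift c0 j = j.+1 :> nat by [].
  case: splitP => k; rewrite li => ik; last by have := ltn _ (ltn_ord i); lia.
  rewrite lj coefX -val_eqE /= -ik -mulrnA mulnb; congr (_ *+ _); lia.
rewrite mxE; case: splitP => k ik; last first.
  by case/eqP: ni; apply: val_inj; rewrite /= ik (ord1 k).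
by rewrite coefX /= mul0rn mul0r.
Qed.

End SylvesterDet.

Lemma sres_morph (R S : comNzRingType) (f : {rmorphism R -> S}) m n
    (p q : {poly R}) :
  f (sres m n p q) = sres m n (map_poly f p) (map_poly f q).
Proof.
rewrite /sres -det_map_mx; congr (\det _); apply/matrixP=> i j; rewrite !mxE.
by case: split => k; rewrite rmorphMn coef_map.
Qed.

Lemma sum_coefs (R : nzRingType) n (p : {poly R}) :
  (size p <= n)%N -> \sum_(k < n) p`_k *: 'X^k = p.
Proof.
move=> sp; rewrite -poly_def; apply/polyP=> i; rewrite coef_poly.
by case: ltnP => // le; rewrite nth_default // (leq_trans sp).
Qed.

Section FieldFormula.
Variables (F : fieldType) (n : nat) (q : {poly F}).
Hypothesis sq : size q = n.+1.

Let q_neq0 : q != 0. Proof. by rewrite -size_poly_gt0 sq. Qed.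

(** The matrix of multiplication by [p] on F[X]/(q) in the basis of powers of X. Its determinant is
    the norm of [p], which is the resultant up to a power of the leading coefficient of [q]. *)
Definition mulmod_mx (p : {poly F}) : 'M[F]_n :=
  \matrix_(i, j) (('X^i * p) %% q)`_j.

Let size_mod (p : {poly F}) : (size (p %% q)%R <= n)%N.
Proof. by rewrite -ltnS -sq ltn_modp. Qed.

(* Division with remainder of X^i p by q, for i < n, factors the Sylvester
   matrix into two block triangular matrices. *)
Lemma sres_mulmod m (p : {poly F}) : (size p <= m.+1)%N ->
  sres m n p q = lead_coef q ^+ m * \det (mulmod_mx p).
Proof.
move=> sp; pose S := \matrix_(i < n, j < m) (('X^i * p) %/ q)`_j.
pose Q1 := \matrix_(i < m, j < n) ('X^i * q)`_j.
pose Q2 := \matrix_(i < m, j < m) ('X^i * q)`_(n + j).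
have -> : sres m n p q =
    \det (block_mx (mulmod_mx p) S 0 1%:M *m block_mx 1%:M 0 Q1 Q2).
  congr (\det _); rewrite mulmx_block !mulmx1 !mul1mx !mulmx0 !add0r.
  have band (r : {poly F}) (i : nat) j : ('X^i * r)`_j = r`_(j - i) *+ (i <= j).
    by rewrite coefXnM ltnNge if_neg -mulrb.
  have dvd (i : 'I_n) : 'X^i * p = (('X^i * p) %/ q) * q + ('X^i * p) %% q.
    exact: divp_eq.
  have SQ (i : 'I_n) j : \sum_(k < m) (('X^i * p) %/ q)`_k * ('X^k * q)`_j =
      (('X^i * p) %/ q * q)`_j.
    have sd : (size (('X^i * p) %/ q)%R <= m)%N.
      rewrite size_divp // sq /= leq_subLR.
      apply: leq_trans (size_polyMleq _ _) _; rewrite size_polyXn.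
      by have := ltn_ord i; lia.
    rewrite -[in RHS](sum_coefs sd) mulr_suml coef_sum.
    by apply: eq_bigr => k _; rewrite -scalerAl coefZ.
  apply/matrixP=> i j; rewrite [LHS]mxE; case: splitP => k ik.
    have -> : i = lshift m k by apply: val_inj.
    rewrite -band dvd coefD.
    case: (splitP j) => l jl.
      have -> : j = lshift m l by apply: val_inj.
      rewrite block_mxEul !mxE addrC; congr (_ + _); rewrite -SQ.
      by apply: eq_bigr => u _; rewrite !mxE.
    have -> : j = rshift n l by apply: val_inj.
    rewrite block_mxEur mxE [X in _ + X]nth_default ?addr0 -?SQ; last first.
      by apply: leq_trans (size_mod _) _; rewrite leq_addr.
    by apply: eq_bigr => u _; rewrite !mxE.
  have -> : i = rshift n k by apply: val_inj.
  rewrite -band; case: (splitP j) => l jl.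
    have -> : j = lshift m l by apply: val_inj.
    by rewrite block_mxEdl mxE.
  have -> : j = rshift n l by apply: val_inj.
  by rewrite block_mxEdr mxE.
rewrite det_mulmx det_ublock det_lblock !det1 mulr1 mul1r mulrC; congr (_ * _).
rewrite det_trig; last first.
  apply/is_trig_mxP => i j ij; rewrite mxE coefXnM.
  case: ifP => // _; apply: nth_default; rewrite sq; lia.
transitivity (\prod_(i < m) lead_coef q); last by rewrite prodr_const card_ord.
apply: eq_bigr => i _.
rewrite mxE coefXnM ifF; last by lia.
by rewrite addnK lead_coefE sq.
Qed.

Lemma mulmod_mxM (p1 p2 : {poly F}) : mulmod_mx (p1 * p2) = mulmod_mx p1 *m mulmod_mx p2.
Proof.
apply/matrixP=> i j; rewrite !mxE.
have -> : ('X^i * (p1 * p2)) %% q = (('X^i * p1) %% q * p2) %% q.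
  by rewrite mulrA [in RHS]mulrC modp_mul mulrC.
rewrite -{1}(sum_coefs (size_mod ('X^i * p1))) mulr_suml.
rewrite (big_morph (fun r => r %% q) (modpD q) (mod0p q)) coef_sum.
by apply: eq_bigr => k _; rewrite !mxE -scalerAl modpZl coefZ.
Qed.

End FieldFormula.

Section SresIdomain.
Variables (R : idomainType) (n : nat) (q : {poly R}).
Hypothesis sq : size q = n.+1.

Local Notation frac := (@FracField.tofrac R).

Let frac_inj : injective frac.
Proof. by move=> x y /eqP; rewrite tofrac_eq => /eqP. Qed.

Let sz_frac (p : {poly R}) : size (map_poly frac p) = size p.
Proof. by rewrite size_map_inj_poly ?rmorph0 //; apply: frac_inj. Qed.

(** Over the field of fractions the resultant is a power of the leading coefficient times a norm,
    and norms are multiplicative. *)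
Lemma sresM m1 m2 (p1 p2 : {poly R}) :
    (size p1 <= m1.+1)%N -> (size p2 <= m2.+1)%N ->
  sres (m1 + m2) n (p1 * p2) q = sres m1 n p1 q * sres m2 n p2 q.
Proof.
move=> s1 s2; apply: frac_inj; rewrite rmorphM !sres_morph rmorphM.
have s12 : (size (p1 * p2)%R <= (m1 + m2).+1)%N.
  by apply: leq_trans (size_polyMleq _ _) _; lia.
rewrite !sres_mulmod -?rmorphM ?sz_frac // rmorphM mulmod_mxM ?sz_frac //.
by rewrite det_mulmx exprD; ring.
Qed.

(** Only the residue modulo [q] enters the norm, and the common formal degree [m] gives the same
    power of the leading coefficient. *)
Lemma sres_modr m (p1 p2 s : {poly R}) :
    (size p1 <= m.+1)%N -> (size p2 <= m.+1)%N -> p1 = p2 + s * q ->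
  sres m n p1 q = sres m n p2 q.
Proof.
move=> s1 s2 e; apply: frac_inj; rewrite !sres_morph.
rewrite !sres_mulmod ?sz_frac //; congr (_ * \det _).
apply/matrixP=> i j; rewrite !mxE e rmorphD rmorphM mulrDr mulrA modpD.
by rewrite modp_mull addr0.
Qed.

End SresIdomain.

(** * Elementary symmetric functions and morphisms *)

(** Recursion on the number of variables makes these functions available at arbitrary values in any
    ring, so that they can be carried along morphisms. *)
Fixpoint elsym (S : nzRingType) (y : nat -> S) (n k : nat) : S :=
  match n, k with
  | _, 0 => 1
  | 0, _ => 0
  | n'.+1, k'.+1 => elsym y n' k + elsym y n' k' * y n'
  end.

Lemma rmorph_mesym (R S : nzRingType) n (f : {rmorphism {mpoly R[n]} -> S})
    (y : nat -> S) k :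
  (forall i, f 'X_i = y i) -> f (mesym n R k) = elsym y n k.
Proof.
elim: n => [|n IHn] in f k *.
  by case: k => [|k] _ /=; rewrite ?mesym0E ?rmorph1 // mesym_geqnE ?rmorph0.
move=> fy; case: k => [|k]; first by rewrite mesym0E rmorph1.
rewrite mesymSS rmorphD rmorphM fy /=.
have H i : (f \o @mwiden n R) 'X_i = y i by rewrite /= mwidenX mnmwiden1 fy.
by rewrite -!(IHn (f \o @mwiden n R)).
Qed.

Lemma elsym_morph (S S' : nzRingType) (f : {rmorphism S -> S'}) y n k :
  f (elsym y n k) = elsym (f \o y) n k.
Proof.
elim: n k => [|n IHn] [|k] /=; rewrite ?rmorph1 ?rmorph0 //.
by rewrite rmorphD rmorphM !IHn.
Qed.

Lemma eq_elsym (S : nzRingType) (y z : nat -> S) n k :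
  (forall i, (i < n)%N -> y i = z i) -> elsym y n k = elsym z n k.
Proof.
elim: n k => [|n IHn] [|k] //= yz; rewrite yz // !IHn // => i lt.
all: by rewrite yz // (ltn_trans lt).
Qed.

Lemma mpoly_morph_eq (R S : nzRingType) n (f g : {rmorphism {mpoly R[n]} -> S}) :
    (forall c, f c%:MP = g c%:MP) -> (forall i, f 'X_i = g 'X_i) -> f =1 g.
Proof.
move=> fgC fgX p; rewrite (mpolyE p) !rmorph_sum; apply: eq_bigr => m _.
rewrite -mul_mpolyC mpolyXE_id !rmorphM !rmorph_prod fgC; congr (_ * _).
by apply: eq_bigr => i _; rewrite !rmorphXn fgX.
Qed.

Lemma mpoly_int_morph_eq (S : nzRingType) n
    (f g : {rmorphism {mpoly int[n]} -> S}) :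
  (forall i, f 'X_i = g 'X_i) -> f =1 g.
Proof.
apply: mpoly_morph_eq => c.
by rewrite -[c]intz !rmorph_int.
Qed.

Lemma elsymS (S : nzRingType) (y : nat -> S) n k :
  elsym y n.+1 k.+1 = elsym y n k.+1 + elsym y n k * y n.
Proof. by []. Qed.

Arguments elsym : simpl never.

(** * The two polynomials in the squared diameter *)

(* With D = 4 r^2 and x0 = 16 K^2 = - 4 u_2, these are 4 t_2, 8 t_3, 64 t_4,
   64 (t_3^2 - 4 u_2 t_4) and 64 t_5. *)
Section Heron.
Variable S : comNzRingType.
Variables (x0 : S) (s : nat -> S) (D : S).

Definition fT2 : S := s 1 ^+ 2 + 2 * s 1 * D - 3 * D ^+ 2 - 4 * s 2 + x0.
Definition fT3 : S := 8 * s 3 + (s 1 + D) * fT2 - 2 * D * (s 1 - D) ^+ 2.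
Definition fT4 : S := fT2 ^+ 2 - 8 * D * (s 1 - D) * fT2 - 64 * s 4.
Definition fA : S := fT3 ^+ 2 + x0 * fT4.
Definition fB : S := 64 * s 5 - D * fT2 ^+ 2.

Definition fG : S :=
  D ^+ 2 * (s 1 - D) ^+ 4 + 4 * s 3 * (s 1 + D) * fT2
  - 8 * s 3 * D * (s 1 - D) ^+ 2 - (s 1 + D) * fT2 * D * (s 1 - D) ^+ 2
  - 2 * x0 * D * (s 1 - D) * fT2.
Definition fH : S :=
  D * s 3 ^+ 2 + (s 1 + D) ^+ 2 * s 5 + x0 * s 5 - x0 * D * s 4.

(* Modulo fB one may replace D fT2^2 by 64 s_5, which makes D fA divisible
   by 4; this is the source of the factor 4^4 of the resultant. *)
Lemma fA_mod_fB :
  D * fA = 4 * (D * fG + 16 * fH) + (- ((s 1 + D) ^+ 2 + x0)) * fB.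
Proof.
rewrite /fA /fB /fG /fH /fT4 /fT3; move: fT2 => T.
by move: (s 1) (s 3) (s 4) (s 5) => s1 s3 s4 s5; ring.
Qed.

End Heron.

Section HeronMorph.
Variables (S S' : comNzRingType) (f : {rmorphism S -> S'}).
Variables (x0 : S) (s : nat -> S) (D : S).

Lemma fT2_morph : f (fT2 x0 s D) = fT2 (f x0) (f \o s) (f D).
Proof. by rewrite /fT2 !(rmorph_nat, rmorphXn, rmorphN, rmorphM, rmorphD) /=. Qed. 

Lemma fA_morph : f (fA x0 s D) = fA (f x0) (f \o s) (f D).
Proof.
by rewrite /fA /fT3 /fT4 !(fT2_morph, rmorph_nat, rmorphXn, rmorphN, rmorphM, rmorphD).
Qed.

Lemma fB_morph : f (fB x0 s D) = fB (f x0) (f \o s) (f D).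
Proof.
by rewrite /fB !(fT2_morph, rmorph_nat, rmorphXn, rmorphN, rmorphM, rmorphD).
Qed.

End HeronMorph.

Lemma fA_weight (S : comNzRingType) (c x0 D : S) s :
  fA (c ^+ 2 * x0) (fun k => c ^+ k * s k) (c * D) = c ^+ 6 * fA x0 s D.
Proof.
rewrite /fA /fT4 /fT3 /fT2; move: (s 1) (s 2) (s 3) (s 4) => s1 s2 s3 s4.
by ring.
Qed.

Lemma fB_weight (S : comNzRingType) (c x0 D : S) s :
  fB (c ^+ 2 * x0) (fun k => c ^+ k * s k) (c * D) = c ^+ 5 * fB x0 s D.
Proof.
by rewrite /fB /fT2; move: (s 1) (s 2) (s 5) => s1 s2 s5; ring.
Qed.

(** * Degrees of the two polynomials in the squared diameter, and their resultant *)

Section SizeBounds.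
Variable S : nzRingType.
Implicit Types p q : {poly S}.

Lemma size_leD p q m n : (size p <= m)%N -> (size q <= n)%N ->
  (size (p + q)%R <= maxn m n)%N.
Proof.
by move=> pm qn; apply: leq_trans (size_polyD _ _) _; rewrite geq_max; lia.
Qed.

Lemma size_leM p q m n : (size p <= m)%N -> (size q <= n)%N ->
  (size (p * q)%R <= (m + n).-1)%N.
Proof. by move=> pm qn; apply: leq_trans (size_polyMleq _ _) _; lia. Qed.

Lemma size_leN p m : (size p <= m)%N -> (size (- p)%R <= m)%N.
Proof. by rewrite size_polyN. Qed.

Lemma size_leX p m k : (size p <= m)%N -> (size (p ^+ k)%R <= (m.-1 * k).+1)%N.
Proof.
by move=> pm; apply: leq_trans (size_poly_exp_leq _ _) _; rewrite ltnS leq_mul2r; lia.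
Qed.

Lemma size_leV : (size ('X : {poly S}) <= 2)%N.
Proof. by rewrite size_polyX. Qed.

Lemma size_leNat k : (size (k%:R : {poly S}) <= 1)%N.
Proof. by rewrite -polyC_natr size_polyC_leq1. Qed.

End SizeBounds.

Ltac size_step := match goal with
  | H : is_true (size (polyseq ?p) <= _)%N |- is_true (size (polyseq ?p) <= _)%N => exact H
  | |- is_true (size (polyseq (- _)%R) <= _)%N => eapply size_leN
  | |- is_true (size (polyseq (_ + _)%R) <= _)%N => eapply size_leD
  | |- is_true (size (polyseq (_ * _)%R) <= _)%N => eapply size_leM
  | |- is_true (size (polyseq (_ ^+ _)%R) <= _)%N => eapply size_leX
  | |- is_true (size (polyseq 'X) <= _)%N => eapply size_leV
  | |- is_true (size (polyseq _%:P) <= _)%N => eapply size_polyC_leq1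
  | |- is_true (size (polyseq _%:R) <= _)%N => eapply size_leNat
  end.

Ltac size_bound := eapply leq_trans; [repeat size_step | by []].

Section HeronPoly.
Variable S : comNzRingType.
Variables (x0 : S) (s : nat -> S).

Definition pA : {poly S} := fA x0%:P (fun k => (s k)%:P) 'X.
Definition pB : {poly S} := fB x0%:P (fun k => (s k)%:P) 'X.
Definition pT2 : {poly S} := fT2 x0%:P (fun k => (s k)%:P) 'X.

Lemma size_pT2 : (size pT2 <= 3)%N.
Proof. rewrite /pT2 /fT2; size_bound. Qed.

Lemma pA_lead : pA = 25%:R *: 'X^6 + (pA - 25%:R *: 'X^6)
  /\ (size (pA - 25%:R *: 'X^6)%R <= 6)%N.
Proof.
split; first by rewrite addrC subrK.
(* As polynomials in the squared diameter, [fT2] is [L - 3 X^2] and [fT3] is [M - 5 X^3]; the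
   leading coefficient 25 is the square of -5. *)
pose L : {poly S} := (s 1 ^+ 2 - 4 * s 2 + x0)%:P + (2 * s 1)%:P * 'X.
have sL : (size L <= 2)%N by rewrite /L; size_bound.
pose M : {poly S} := (8 * s 3)%:P + (s 1)%:P * (L - 3 * 'X^2) + 'X * L
  - 2 * (s 1 ^+ 2)%:P * 'X + 4 * (s 1)%:P * 'X^2.
have sM : (size M <= 3)%N by rewrite /M; size_bound.
pose N : {poly S} := M ^+ 2 - 10 * M * 'X^3 + x0%:P * ((L - 3 * 'X^2) ^+ 2 - 8 * 'X * ((s 1)%:P - 'X) * (L - 3 * 'X^2) - 64 * (s 4)%:P).
have sN : (size N <= 6)%N by rewrite /N; size_bound.
suff -> : pA - 25%:R *: 'X^6 = N by [].
rewrite -mul_polyC /pA /fA /fT3 /fT4 /fT2 /N /M /L.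
by rewrite !(polyC_natr, polyC_exp, polyCN, polyCM, polyCD); ring.
Qed.

End HeronPoly.

Lemma pB_lead (S : comNzRingType) (x0 : S) s :
  (size (pB x0 s - (- 9%:R) *: 'X^5)%R <= 5)%N.
Proof.
pose L : {poly S} := (s 1 ^+ 2 - 4 * s 2 + x0)%:P + (2 * s 1)%:P * 'X.
have sL : (size L <= 2)%N by rewrite /L; size_bound.
pose N : {poly S} := 64 * (s 5)%:P - 'X * (L ^+ 2 - 6 * L * 'X^2).
have sN : (size N <= 5)%N by rewrite /N; size_bound.
suff -> : pB x0 s - (- 9%:R) *: 'X^5 = N by [].
rewrite -mul_polyC /pB /fB /fT2 /N /L.
by rewrite !(polyC_natr, polyC_exp, polyCN, polyCM, polyCD); ring.
Qed.

Lemma size_lead (S : nzRingType) (p : {poly S}) c n :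
  c != 0 -> (size (p - c *: 'X^n)%R <= n)%N -> size p = n.+1.
Proof.
move=> c0 sr; have sp : (size p <= n.+1)%N.
  rewrite -[p](subrK (c *: 'X^n)); apply: leq_trans (size_polyD _ _) _.
  by rewrite geq_max (leqW sr) (leq_trans (size_scale_leq _ _)) ?size_polyXn.
apply/eqP; rewrite eqn_leq sp ltnNge; apply: contra c0 => sn.
have /leq_sizeP/(_ n (leqnn n)) := sr.
by rewrite coefB coefZ coefXn eqxx mulr1 (leq_sizeP _ _ sn) // sub0r => /eqP; rewrite oppr_eq0.
Qed.

Lemma size_pA (S : comNzRingType) (x0 : S) s :
  25%:R != 0 :> S -> size (pA x0 s) = 7%N.
Proof. by move=> nz; apply: size_lead nz (pA_lead x0 s).2. Qed.

Lemma size_pB (S : comNzRingType) (x0 : S) s :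
  9%:R != 0 :> S -> size (pB x0 s) = 6%N.
Proof. by move=> nz; apply: size_lead (pB_lead x0 s); rewrite oppr_eq0. Qed.

Definition heron_res (S : comNzRingType) (x0 : S) (s : nat -> S) : S :=
  sres 6 5 (pA x0 s) (pB x0 s).

Lemma eq_fA (S : comNzRingType) (x0 D : S) s s' :
  (forall k, (0 < k <= 5)%N -> s k = s' k) -> fA x0 s D = fA x0 s' D.
Proof. by move=> e; rewrite /fA /fT3 /fT4 /fT2 !e. Qed.

Lemma eq_fB (S : comNzRingType) (x0 D : S) s s' :
  (forall k, (0 < k <= 5)%N -> s k = s' k) -> fB x0 s D = fB x0 s' D.
Proof. by move=> e; rewrite /fB /fT2 !e. Qed.

Lemma eq_heron_res (S : comNzRingType) (x0 : S) s s' :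
  (forall k, (0 < k <= 5)%N -> s k = s' k) -> heron_res x0 s = heron_res x0 s'.
Proof.
move=> e; congr (sres _ _ _ _).
  by apply: eq_fA => k /e ->.
by apply: eq_fB => k /e ->.
Qed.

Lemma map_pA (S S' : comNzRingType) (f : {rmorphism S -> S'}) x0 s :
  map_poly f (pA x0 s) = pA (f x0) (f \o s).
Proof.
rewrite /pA fA_morph /= map_polyC map_polyX; apply: eq_fA => k _ /=.
by rewrite map_polyC.
Qed.

Lemma map_pB (S S' : comNzRingType) (f : {rmorphism S -> S'}) x0 s :
  map_poly f (pB x0 s) = pB (f x0) (f \o s).
Proof.
rewrite /pB fB_morph /= map_polyC map_polyX; apply: eq_fB => k _ /=.
by rewrite map_polyC.
Qed.

Lemma heron_res_morph (S S' : comNzRingType) (f : {rmorphism S -> S'}) x0 s :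
  f (heron_res x0 s) = heron_res (f x0) (f \o s).
Proof. by rewrite /heron_res sres_morph map_pA map_pB. Qed.

Lemma horner_pA (S : comNzRingType) (x0 D : S) s : (pA x0 s).[D] = fA x0 s D.
Proof.
rewrite -horner_evalE /pA fA_morph /= /horner_eval hornerC hornerX.
by apply: eq_fA => k _; rewrite /= /horner_eval hornerC.
Qed.

Lemma horner_pB (S : comNzRingType) (x0 D : S) s : (pB x0 s).[D] = fB x0 s D.
Proof.
rewrite -horner_evalE /pB fB_morph /= /horner_eval hornerC hornerX.
by apply: eq_fB => k _; rewrite /= /horner_eval hornerC.
Qed.

(** The resultant lies in the ideal generated by the two polynomials. That 25 and 9 are nonzero
    makes the true degrees equal to the formal degrees 6 and 5. *)
Lemma heron_res_common_root (S : comNzRingType) (x0 D : S) s :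
    25%:R != 0 :> S -> 9%:R != 0 :> S ->
  fA x0 s D = 0 -> fB x0 s D = 0 -> heron_res x0 s = 0.
Proof.
move=> nz25 nz9 A0 B0; have sA := size_pA x0 s nz25; have sB := size_pB x0 s nz9.
have sA1 : (1 < size (pA x0 s))%N by rewrite sA.
have sB1 : (1 < size (pB x0 s))%N by rewrite sB.
have [[u v] _ e] := resultant_in_ideal sA1 sB1.
rewrite /heron_res -(resultant_sres sA sB) -[LHS](hornerC _ D) e hornerD !hornerM.
by rewrite horner_pA horner_pB A0 B0 !mulr0 addr0.
Qed.

Section Idomain.
Variable R : idomainType.
Variables (x0 : R) (s : nat -> R).

(** Substituting [c X] multiplies the resultant by [c ^+ 30], while by homogeneity it extracts
    [c ^+ 6] and [c ^+ 5] from the two polynomials, that is [c ^+ 60] from the resultant; [c ^+ 30]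
    remains. *)
Lemma heron_res_weight (c : R) : c != 0 ->
  heron_res (c ^+ 2 * x0) (fun k => c ^+ k * s k) = c ^+ 30 * heron_res x0 s.
Proof.
move=> c0; set s' := fun k => _.
have eA : pA (c ^+ 2 * x0) s' \Po (c *: 'X) = c ^+ 6 *: pA x0 s.
  rewrite -[RHS]mul_polyC polyC_exp -fA_weight.
  rewrite -[LHS]/(comp_poly (c *: 'X) _) /pA fA_morph /= !comp_polyC comp_polyX.
  rewrite -mul_polyC polyCM polyC_exp; apply: eq_fA => k _ /=.
  by rewrite comp_polyC /s' polyCM polyC_exp.
have eB : pB (c ^+ 2 * x0) s' \Po (c *: 'X) = c ^+ 5 *: pB x0 s.
  rewrite -[RHS]mul_polyC polyC_exp -fB_weight.
  rewrite -[LHS]/(comp_poly (c *: 'X) _) /pB fB_morph /= !comp_polyC comp_polyX.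
  rewrite -mul_polyC polyCM polyC_exp; apply: eq_fB => k _ /=.
  by rewrite comp_polyC /s' polyCM polyC_exp.
have := sres_scale_eq 6 5 (pA (c ^+ 2 * x0) s') (pB (c ^+ 2 * x0) s') 1 1 c.
rewrite /= !scale1r eA eB sresZ !expr1n !mul1r -/(heron_res _ _) -/(heron_res _ _).
have nz k : \prod_(i < k) c ^+ i != 0.
  by apply/prodf_neq0 => i _; rewrite expf_neq0.
move/(mulfI (mulf_neq0 (nz 5) (nz 6))).
rewrite -!exprM -exprD -[(6 * 5 + 5 * 6)%N]/(30 + 30)%N exprD -mulrA.
by move/(mulfI (expf_neq0 30 c0)).
Qed.

Lemma heron_res_div256 : 2%:R != 0 :> R -> 9%:R != 0 :> R ->
  exists k, s 5 * heron_res x0 s = 256%:R * k.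
Proof.
move=> nz2 nz9; have sB := size_pB x0 s nz9; have sA := (pA_lead x0 s).
pose pG := fG x0%:P (fun k => (s k)%:P) 'X.
pose pH := fH x0%:P (fun k => (s k)%:P) 'X.
have sG : (size pG <= 7)%N.
  have := size_pT2 x0 s; rewrite /pG /fG -/(pT2 x0 s); set T := pT2 _ _ => sT.
  by size_bound.
have sH : (size pH <= 3)%N by rewrite /pH /fH; size_bound.
have sA7 : (size (pA x0 s) <= 7)%N.
  rewrite (pA_lead x0 s).1; apply: leq_trans (size_polyD _ _) _.
  by rewrite geq_max (leq_trans (size_scale_leq _ _)) ?size_polyXn ?(leq_trans (pA_lead x0 s).2).
have sX : (size ('X : {poly R}) <= 2)%N by rewrite size_polyX.
pose C : {poly R} := 'X * pG + 16%:R *: pH.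
have sC : (size C <= 8)%N by rewrite /C -mul_polyC; size_bound.
have eA : 'X * pA x0 s = 4%:R *: C
    + (- (((s 1)%:P + 'X) ^+ 2 + x0%:P)) * pB x0 s.
  rewrite -mul_polyC /C -mul_polyC !polyC_natr; exact: fA_mod_fB.
(* Res(X, B) Res(A, B) = Res(X A, B) = Res(4 C, B), because X A and 4 C are congruent modulo B. *)
have e1 : sres 1 5 'X (pB x0 s) * heron_res x0 s = 4 ^+ 5 * sres 7 5 C (pB x0 s).
  rewrite -(sresM sB (m1 := 1) (m2 := 6)) //.
  rewrite (sres_modr sB (p2 := 4%:R *: C) _ _ eA).
  - by rewrite -[pB _ _ in LHS]scale1r sresZ expr1n mulr1.
  - by size_bound.
  - by rewrite -mul_polyC; size_bound.
(* Modulo 16 the polynomial [C] is [X G], whose resultant splits off Res(X, B) again. *)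
have [k ek] := sres_cong 7 5 ('X * pG) pH (pB x0 s) 16%:R.
have B0 : (pB x0 s)`_0 = 64 * s 5.
  by rewrite -horner_coef0 horner_pB /fB; ring.
rewrite ek (sresM sB (m1 := 1) (m2 := 6)) // in e1.
move: e1; rewrite (sresX sB) B0; set g := sres 6 5 pG _; set r := heron_res x0 s => e1.
(* Obtained on dividing [- 64 s5 r = 4^5 (- 64 s5 g + 16 k)] by -64. *)
exists (4 * s 5 * g - k).
have nz64 : 64%:R != 0 :> R.
  by rewrite (_ : 64%:R = 2%:R ^+ 6 :> R) ?expf_neq0 //; ring.
apply: (mulfI nz64).
transitivity (- ((-1) ^+ 5 * (64 * s 5) * r)); first by ring.
by rewrite e1; ring.
Qed.

End Idomain.

(** * The leading coefficient *)

(** Laplace expansion along the first column that skips zero entries, over binary integers, so that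
    a sparse determinant of order 11 can be computed. *)
Fixpoint laplaceZ (n : nat) (rows : seq (seq Z)) : Z :=
  if n is n'.+1 then
    foldr (fun i (acc : Z) =>
      let a := head 0 (nth [::] rows i) in
      if Z.eqb a 0 then acc else
      Z.add (Z.mul (if odd i then Z.opp a else a)
               (laplaceZ n' (map behead (take i rows ++ drop i.+1 rows)))) acc)
      0 (iota 0 n)
  else 1.

Lemma laplaceZE n rows : size rows = n ->
  laplaceZ n rows = \det (\matrix_(i < n, j < n) nth 0 (nth [::] rows i) j).
Proof.
elim: n rows => [|n IHn] rows sz; first by rewrite det_mx00.
rewrite (expand_det_col _ ord0).
pose F i : Z := (if odd i then - head 0 (nth [::] rows i) else head 0 (nth [::] rows i))
  * laplaceZ n (map behead (take i rows ++ drop i.+1 rows)).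
transitivity (\sum_(i < n.+1) F i).
  rewrite -(big_mkord xpredT F) /index_iota subn0 [LHS]/laplaceZ -/laplaceZ.
  elim: (iota 0 n.+1) => [|i l IHl]; first by rewrite big_nil.
  rewrite big_cons /= IHl /F.
  case: Z.eqb_spec => [-> | _] //; by rewrite oppr0 if_same mul0r add0r.
apply: eq_bigr => i _; rewrite /F mxE /cofactor addn0 nth0.
have ri := ltn_ord i.
have -> : \det (row' i (col' ord0 (\matrix_(i0 < n.+1, j < n.+1) nth 0 (nth [::] rows i0) j))) =
    laplaceZ n (map behead (take i rows ++ drop i.+1 rows)).
  have sz' : size (take i rows ++ drop i.+1 rows) = n.
    by rewrite size_cat size_take size_drop sz ri; lia.
  rewrite IHn ?size_map //; congr (\det _); apply/matrixP=> k l; rewrite !mxE.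
  rewrite (nth_map [::]) ?sz' // nth_behead; congr (nth _ _ _).
  rewrite nth_cat size_take sz ri /= /bump.
  case: ltnP => ki; first by rewrite nth_take.
  by rewrite nth_drop; congr (nth _ _ _); rewrite add1n addSn subnKC.
by rewrite mulrA -signr_odd; case: (odd i); rewrite ?expr1 ?expr0 ?mulr1 ?mulrN1.
Qed.

Definition sylZ (m n : nat) (a b : seq Z) : seq (seq Z) :=
  let band k c := [seq [seq (if (i <= j)%N then nth 0 c (j - i) else 0)
                       | j <- iota 0 (n + m)] | i <- iota 0 k] in
  band n a ++ band m b.

Lemma sres_laplaceZ m n (a b : seq Z) :
  sres m n (Poly a) (Poly b) = laplaceZ (n + m) (sylZ m n a b).
Proof.
rewrite laplaceZE; last by rewrite size_cat !size_map !size_iota.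
congr (\det _); apply/matrixP=> i j; rewrite !mxE nth_cat size_map size_iota.
have band k (c : seq Z) (i' : nat) : (i' < k)%N ->
    nth 0 (nth [::] [seq [seq (if (i <= j)%N then nth 0 c (j - i) else 0)
                       | j <- iota 0 (n + m)] | i <- iota 0 k] i') j =
    (Poly c)`_(j - i') *+ (i' <= j).
  move=> ik; rewrite (nth_map 0%N) ?size_iota // nth_iota // add0n.
  rewrite (nth_map 0%N) ?size_iota // nth_iota // add0n coef_Poly.
  by case: leqP.
by case: splitP => k ->; rewrite ?addKn band.
Qed.

Lemma heron_res_lead : heron_res (1 : int) (fun _ => 0) = 256.
Proof.
have -> : heron_res (1 : int) (fun _ => 0) = heron_res (int_of_Z 1) (int_of_Z \o (fun _ => 0)).
  by congr (heron_res _ _); rewrite ?rmorph1 //; apply/funext => k; rewrite /= rmorph0.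
rewrite -heron_res_morph (_ : heron_res _ _ = 256%:R) //.
have eA : pA (1 : Z) (fun _ => 0) = Poly [:: 1; 0; 3; 0; -25; 0; 25].
  rewrite /= !cons_poly_def /pA /fA /fT3 /fT4 /fT2 !(polyC0, polyC1) /=.
  by ring.
have eB : pB (1 : Z) (fun _ => 0) = Poly [:: 0; -1; 0; 6; 0; -9].
  rewrite /= !cons_poly_def /pB /fB /fT2 !(polyC0, polyC1).
  by ring.
by rewrite /heron_res eA eB sres_laplaceZ; vm_compute.
Qed.

(** * The integral polynomial *)

Lemma elsym_top (S : nzRingType) (y : nat -> S) n :
  elsym y n n = \prod_(i < n) y i.
Proof.
have big k l : (k < l)%N -> elsym y k l = 0.
  elim: k l => [|k IH] [|l] //= kl.
  by rewrite elsymS !IH ?mul0r ?addr0 // ltnW.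
elim: n => [|n IHn]; first by rewrite big_ord0.
by rewrite big_ord_recr elsymS big ?ltnSn // add0r IHn.
Qed.

Lemma elsym_weight (S : comNzRingType) (c : S) (y : nat -> S) n k :
  elsym (fun i => c * y i) n k = c ^+ k * elsym y n k.
Proof.
elim: n k => [|n IHn] [|k]; 
  rewrite ?elsymS ?IHn ?exprS; try by rewrite /elsym ?mulr0 ?mulr1.
by ring.
Qed.

Definition xside (R : nzRingType) (i : nat) : {mpoly R[6]} := 'X_(inord i.+1).

Lemma inord_lift (i : 'I_5) : inord i.+1 = lift ord0 i :> 'I_6.
Proof. by apply: val_inj; rewrite /= inordK // ltnS. Qed.

Definition heron_res_int : {mpoly int[6]} := heron_res 'X_ord0 (elsym (@xside int) 5).

(** Multiplication by a monomial only shifts coefficients, so it does not affect divisibility by a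
    constant. *)
Lemma mpoly_dvd_mulX n (R : comNzRingType) (a : R) (p k : {mpoly R[n]}) m :
  'X_[m] * p = a *: k -> exists q, p = a *: q.
Proof.
move=> e; exists (\sum_(u <- msupp p) k@_(m + u) *: 'X_[u]).
rewrite [LHS]mpolyE scaler_sumr; apply: eq_bigr => u _.
by rewrite scalerA -mcoeffZ -e mulrC mcoeffMX.
Qed.

(** The fifth elementary symmetric function is a monomial in the variables, so it cancels from the
    divisibility by 256. *)
Lemma heron_res_int_div : exists P, heron_res_int = 256%:R * P.
Proof.
have nz k : k.+1%:R != 0 :> {mpoly int[6]}.
  by rewrite -mpolyC_nat mpolyC_eq0 pnatr_eq0.
have [k e] := heron_res_div256 'X_ord0 (elsym (@xside int) 5) (nz 1) (nz 8).
have [m em] : exists m, elsym (@xside int) 5 5 = 'X_[m].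
  rewrite elsym_top; elim/big_ind: _ => [|p q [m ->] [m' ->]|i _].
  - by exists 0%MM; rewrite mpolyX0.
  - by exists (m + m')%MM; rewrite mpolyXD.
  - by exists U_(inord i.+1)%MM.
have [|q eq] := @mpoly_dvd_mulX _ _ (256%:R) heron_res_int k m.
  by rewrite -em e -mul_mpolyC mpolyC_nat.
by exists q; rewrite eq -mul_mpolyC mpolyC_nat.
Qed.

Section Quotient.
Variable P : {mpoly int[6]}.
Hypothesis res_P : heron_res_int = 256%:R * P.

Definition wt n (m : 'X_{1..n.+1}) : nat := (2 * m ord0 + \sum_(i < n) m (lift ord0 i))%N.

(** Replacing each variable of weight w by 2^w times itself multiplies [P] by 2^30 and every
    monomial by 2 to the power of its weight; comparing coefficients gives the weight. *)
Lemma alpha_weight m : m \in msupp P -> wt m = 30%N.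
Proof.
pose w (i : 'I_6) := if i == ord0 then 2%N else 1%N.
pose h (i : 'I_6) : {mpoly int[6]} := (2%:R ^+ w i)%:MP * 'X_i.
pose phi := mmap (@mpolyC 6 int) h.
have wtE (m' : 'X_{1..6}) : wt m' = (\sum_i w i * m' i)%N.
  rewrite big_ord_recl /wt /w eqxx; congr (_ + _)%N.
  by apply: eq_bigr => i _; rewrite lift_eqF mul1n.
have phiX (m' : 'X_{1..6}) : phi 'X_[m'] = (2 ^+ wt m')%:MP * 'X_[m'].
  rewrite /phi mmapX /mmap1 wtE expr_sum rmorph_prod [in RHS]mpolyXE_id -big_split.
  by apply: eq_bigr => i _; rewrite /h exprMn exprM rmorphXn.
have phiU i : phi 'X_i = (2%:R ^+ w i)%:MP * 'X_i by rewrite /phi mmapX mmap1U.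
have phi_res : phi heron_res_int = 2%:R ^+ 30 * heron_res_int.
  transitivity (heron_res (phi 'X_ord0) (phi \o elsym (@xside int) 5)).
    exact: heron_res_morph.
  have -> : phi 'X_ord0 = 2%:R ^+ 2 * 'X_ord0.
    by rewrite phiU /w eqxx rmorphXn /= mpolyC_nat.
  have -> : phi \o elsym (@xside int) 5 = fun k => 2%:R ^+ k * elsym (@xside int) 5 k.
    apply/funext => k; rewrite -elsym_weight /= [LHS]elsym_morph.
    apply: eq_elsym => i i5; rewrite /xside /= -[LHS]/(phi _) phiU /w.
    by rewrite (inord_lift (Ordinal i5)) lift_eqF expr1 mpolyC_nat.
  by rewrite heron_res_weight // -mpolyC_nat mpolyC_eq0 pnatr_eq0.
have phiP : phi P = 2%:R ^+ 30 * P.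
  have nz : 256%:R != 0 :> {mpoly int[6]}.
    by rewrite -mpolyC_nat mpolyC_eq0 pnatr_eq0.
  apply: (mulfI nz); rewrite mulrCA -res_P -phi_res res_P /phi rmorphM rmorph_nat.
  by [].
move=> mP.
have : (phi P)@_m = 2 ^+ wt m * P@_m.
  have phi1 u : mmap1 h u = (2 ^+ wt u)%:MP * 'X_[u] by rewrite -phiX /phi mmapX.
  rewrite /phi /mmap raddf_sum /= (bigD1_seq m) //= phi1 mcoeffCM mcoeffCM.
  rewrite mcoeffX eqxx mulr1 big1 ?addr0 1?mulrC // => u um.
  by rewrite phi1 !mcoeffCM mcoeffX (negbTE um) !mulr0.
rewrite phiP -mpolyC_nat -rmorphXn mcoeffCM /=.
move/mulIf; rewrite -mcoeff_msupp => /(_ mP) /eqP.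
rewrite -!natrX eqr_nat eqn_exp2l // => /eqP.
by [].
Qed.

(** Evaluate at 1 in the first variable and 0 in the others. In weight 30 only monomials with
    exponent 15 in the first variable survive, and [heron_res_lead] gives the value of [256 * P]. *)
Lemma alpha_lead_sum : \sum_(m <- msupp P | m ord0 == 15%N) P@_m = 1.
Proof.
pose h (i : 'I_6) : int := (i == ord0)%:R.
have h0 : h ord0 = 1 by [].
have hl i : h (lift ord0 i) = 0 by rewrite /h lift_eqF.
have h1 m : m \in msupp P -> mmap1 h m = (m ord0 == 15%N)%:R.
  move=> /alpha_weight wm; rewrite /wt in wm.
  rewrite /mmap1 big_ord_recl h0 expr1n mul1r.
  have [m0|m0] := eqVneq (m ord0) 15%N.
    rewrite big1 // => i _; rewrite (_ : m (lift ord0 i) = 0%N) //.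
    by move: wm; rewrite m0 (bigD1 i) //=; lia.
  have [i mi] : exists i, m (lift ord0 i) != 0%N.
    apply/existsP; apply: contra_neqT m0; rewrite negb_exists => /forallP z.
    rewrite big1 in wm; first by lia.
    by move=> i _; move: (z i); rewrite negbK => /eqP.
  by rewrite (bigD1 i) //= hl expr0n (negbTE mi) mul0r.
have e : meval h P = \sum_(m <- msupp P | m ord0 == 15%N) P@_m.
  rewrite mevalE [RHS]big_mkcond big_seq [RHS]big_seq; apply: eq_bigr => m mP.
  by rewrite -[X in _ * X]/(mmap1 h m) (h1 m mP); case: eqP; rewrite ?mulr1 ?mulr0.
rewrite -e; have nz : 256%:R != 0 :> int by [].
apply: (mulfI nz); rewrite mulr1 -[RHS]heron_res_lead.
transitivity (meval h heron_res_int); first by rewrite res_P mevalM rmorph_nat.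
transitivity (heron_res (meval h 'X_ord0) (meval h \o elsym (@xside int) 5)).
  exact: heron_res_morph.
rewrite mevalXU h0; apply: eq_heron_res => k /andP[k0 k5].
rewrite /= [LHS]elsym_morph (@eq_elsym _ _ (fun i => 0 * 0)).
  by rewrite elsym_weight expr0n gtn_eqF // mul0r.
move=> i i5; rewrite /= /xside mevalXU (inord_lift (Ordinal i5)) hl.
by rewrite mul0r.
Qed.

Lemma in_firstE (n : nat) (Q : {mpoly int[n.+1]}) :
  in_first Q = \sum_(m <- msupp Q)
    (Q@_m *: \prod_(i < n) 'X_i ^+ m (lift ord0 i))%:P * 'X^(m ord0).
Proof.
apply: eq_bigr => m _; rewrite /mmap1 big_ord_recl unlift_none.
under eq_bigr => i _ do rewrite liftK -polyC_exp.
by rewrite -rmorph_prod mulrCA mulrC -polyCM mul_mpolyC.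
Qed.

Lemma size_in_first : (size (in_first P) <= 16)%N.
Proof.
rewrite in_firstE big_seq; apply: (big_ind (fun p => size (polyseq p) <= 16)%N).
- by rewrite size_poly0.
- by move=> p q sp sq; apply: leq_trans (size_polyD _ _) _; rewrite geq_max sp.
move=> m /alpha_weight wm; rewrite mul_polyC; apply: leq_trans (size_scale_leq _ _) _.
by rewrite size_polyXn; move: wm; rewrite /wt; lia.
Qed.

Lemma coef15_in_first : (in_first P)`_15 = 1.
Proof.
rewrite in_firstE coef_sum -[RHS]mpolyC1 -alpha_lead_sum.
rewrite (big_morph _ (@mpolyCD _ _) (@mpolyC0 _ _)) [RHS]big_mkcond.
rewrite big_seq [RHS]big_seq; apply: eq_bigr => m /alpha_weight wm.
rewrite coefCM coefXn eq_sym; case: eqP => m0; last by rewrite mulr0.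
rewrite mulr1 big1 ?alg_mpolyC // => i _.
rewrite (_ : m (lift ord0 i) = 0%N) //.
by move: wm; rewrite /wt m0 (bigD1 i) //=; lia.
Qed.

Lemma monic_in_first : in_first P \is monic.
Proof.
apply/monicP; rewrite lead_coefE; suff -> : size (in_first P) = 16%N.
  exact: coef15_in_first.
apply/eqP; rewrite eqn_leq size_in_first ltnNge.
apply/negP => /leq_sizeP/(_ 15%N (leqnn _)); rewrite coef15_in_first.
by move/eqP; rewrite oner_eq0.
Qed.

Lemma alpha_homog : weighted_homog P.
Proof. by exists 30%N => m; apply: alpha_weight. Qed.

End Quotient.

(** * Semicyclic hexagons are zeros *)

Lemma elsym5 (S : comNzRingType) (y : nat -> S) :
  [/\ elsym y 5%N 1 = y 0%N + y 1%N + y 2%N + y 3%N + y 4%N,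
      elsym y 5%N 2 = y 0%N * y 1%N + y 0%N * y 2%N + y 0%N * y 3%N + y 0%N * y 4%N + y 1%N * y 2%N
        + y 1%N * y 3%N + y 1%N * y 4%N + y 2%N * y 3%N + y 2%N * y 4%N + y 3%N * y 4%N,
      elsym y 5%N 3 = y 0%N * y 1%N * y 2%N + y 0%N * y 1%N * y 3%N + y 0%N * y 1%N * y 4%N
        + y 0%N * y 2%N * y 3%N + y 0%N * y 2%N * y 4%N + y 0%N * y 3%N * y 4%N + y 1%N * y 2%N * y 3%N
        + y 1%N * y 2%N * y 4%N + y 1%N * y 3%N * y 4%N + y 2%N * y 3%N * y 4%N,
      elsym y 5%N 4 = y 0%N * y 1%N * y 2%N * y 3%N + y 0%N * y 1%N * y 2%N * y 4%N
        + y 0%N * y 1%N * y 3%N * y 4%N + y 0%N * y 2%N * y 3%N * y 4%N + y 1%N * y 2%N * y 3%N * y 4%N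
    & elsym y 5%N 5 = y 0%N * y 1%N * y 2%N * y 3%N * y 4%N].
Proof.
rewrite !elsymS; cbv beta iota delta [elsym].
by move: (y 0%N) (y 1%N) (y 2%N) (y 3%N) (y 4%N) => *; split; ring.
Qed.

(* With Y = s + 1/s the left-hand side is the product of T(s) and T(1/s), where
   T(s) = \prod_i (s + q_i). *)
Lemma prod_reciprocal (S : comNzRingType) (Y q0 q1 q2 q3 q4 : S) :
  let q k := nth 0 [:: q0; q1; q2; q3; q4] k in
  let t := elsym q 5 in
  (q0 ^+ 2 + Y * q0 + 1) * (q1 ^+ 2 + Y * q1 + 1) * (q2 ^+ 2 + Y * q2 + 1)
   * (q3 ^+ 2 + Y * q3 + 1) * (q4 ^+ 2 + Y * q4 + 1) =
  (1 + t 1%N ^+ 2 + t 2%N ^+ 2 + t 3%N ^+ 2 + t 4%N ^+ 2 + t 5%N ^+ 2)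
  + (t 1%N + t 1%N * t 2%N + t 2%N * t 3%N + t 3%N * t 4%N + t 4%N * t 5%N) * Y
  + (t 2%N + t 1%N * t 3%N + t 2%N * t 4%N + t 3%N * t 5%N) * (Y ^+ 2 - 2)
  + (t 3%N + t 1%N * t 4%N + t 2%N * t 5%N) * (Y ^+ 3 - 3 * Y)
  + (t 4%N + t 1%N * t 5%N) * (Y ^+ 4 - 4 * Y ^+ 2 + 2)
  + t 5%N * (Y ^+ 5 - 5 * Y ^+ 3 + 5 * Y).
Proof.
move=> q t; have [e1 e2 e3 e4 e5] := elsym5 q.
by rewrite /t e1 e2 e3 e4 e5 /q /=; ring.
Qed.

Section UnitCircle.
Variable F : fieldType.
Variables q0 q1 q2 q3 q4 : F.
Hypothesis prod_q : q0 * q1 * q2 * q3 * q4 = -1.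

Let q k := nth 0 [:: q0; q1; q2; q3; q4] k.
Let y k := 2 - q k - (q k)^-1.
Let t := elsym q 5.

(** Since [q i * (z - y i) = q i ^+ 2 + (z - 2) * q i + 1], the product of the [z - y i] is given by
    [prod_reciprocal] at [Y = z - 2]; the coefficients of the powers of z are then compared. *)
Lemma elsym_circle :
  let c0 := 2 + t 1%N ^+ 2 + t 2%N ^+ 2 + t 3%N ^+ 2 + t 4%N ^+ 2 in
  let c1 := t 1%N + t 1%N * t 2%N + t 2%N * t 3%N + t 3%N * t 4%N - t 4%N in
  let c2 := t 2%N + t 1%N * t 3%N + t 2%N * t 4%N - t 3%N in
  let c3 := t 3%N + t 1%N * t 4%N - t 2%N in
  let c4 := t 4%N - t 1%N in
  [/\ elsym y 5%N 1 = c4 + 10,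
      elsym y 5%N 2 = - (c3 - 8 * c4 - 35),
      elsym y 5%N 3 = c2 - 6 * c3 + 20 * c4 + 50,
      elsym y 5%N 4 = - (c1 - 4 * c2 + 9 * c3 - 16 * c4 - 25)
    & elsym y 5%N 5 = c0 - 2 * c1 + 2 * c2 - 2 * c3 + 2 * c4 + 2].
Proof.
move=> c0 c1 c2 c3 c4.
have nz : [&& q0 != 0, q1 != 0, q2 != 0, q3 != 0 & q4 != 0].
  have : q0 * q1 * q2 * q3 * q4 != 0 by rewrite prod_q oppr_eq0 oner_eq0.
  by rewrite !mulf_eq0 !negb_or -!andbA.
case/and5P: nz => nz0 nz1 nz2 nz3 nz4.
have t5 : t 5%N = -1 by rewrite /t; case: (elsym5 q) => _ _ _ _ ->.
have e (z : {poly F}) : \prod_(i < 5) (z - (y i)%:P) =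
   - (c0%:P + c1%:P * (z - 2) + c2%:P * (z ^+ 2 - 4 * z + 2)
      + c3%:P * (z ^+ 3 - 6 * z ^+ 2 + 9 * z - 2)
      + c4%:P * (z ^+ 4 - 8 * z ^+ 3 + 20 * z ^+ 2 - 16 * z + 2)
      - (z ^+ 5 - 10 * z ^+ 4 + 35 * z ^+ 3 - 50 * z ^+ 2 + 25 * z - 2)).
  have qy (x : F) : x != 0 -> x%:P * (z - (2 - x - x^-1)%:P) = x%:P ^+ 2 + (z - 2) * x%:P + 1.
    move=> nx; transitivity (x%:P ^+ 2 + (z - 2) * x%:P + (x * x^-1)%:P).
      by rewrite !(polyCD, polyCN, polyCM, polyC_natr); ring.
    by rewrite divff.
  have P1 : (q0 * q1 * q2 * q3 * q4)%:P * \prod_(i < 5) (z - (y i)%:P) =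
    (q0%:P * (z - (y 0%N)%:P)) * (q1%:P * (z - (y 1%N)%:P)) * (q2%:P * (z - (y 2%N)%:P))
    * (q3%:P * (z - (y 3%N)%:P)) * (q4%:P * (z - (y 4%N)%:P)).
    by rewrite !big_ord_recr big_ord0 /= !polyCM; ring.
  move: P1; rewrite /y /q /= !qy // prod_reciprocal prod_q.
  set tp := elsym _ _.
  have tpE k : tp k = (t k)%:P.
    rewrite /t [RHS]elsym_morph; apply: eq_elsym => i.
    by case: i => [|[|[|[|[|i]]]]].
  rewrite !tpE t5 polyCN polyC1 mulN1r => /(canRL (@opprK _)) ->.
  rewrite /c0 /c1 /c2 /c3 /c4; move: (t 1%N) (t 2%N) (t 3%N) (t 4%N) => a1 a2 a3 a4.
  rewrite !(polyCD, polyCN, polyCM, polyC_natr, polyC_exp).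
  by congr (- _); ring.
have eX := e 'X; rewrite !big_ord_recr big_ord0 /= in eX.
have ePoly : Poly [:: - elsym y 5%N 5; elsym y 5%N 4; - elsym y 5%N 3; elsym y 5%N 2; - elsym y 5%N 1; 1]
   = Poly [:: - (c0 - 2 * c1 + 2 * c2 - 2 * c3 + 2 * c4 + 2);
              - (c1 - 4 * c2 + 9 * c3 - 16 * c4 - 25);
              - (c2 - 6 * c3 + 20 * c4 + 50); - (c3 - 8 * c4 - 35);
              - (c4 + 10); 1].
  rewrite /= !cons_poly_def.
  transitivity (1 * ('X - (y 0%N)%:P) * ('X - (y 1%N)%:P) * ('X - (y 2%N)%:P) *
     ('X - (y 3%N)%:P) * ('X - (y 4%N)%:P)).
    case: (elsym5 y) => -> -> -> -> ->.
    move: (y 0%N) (y 1%N) (y 2%N) (y 3%N) (y 4%N) => *.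
    by rewrite !(polyCD, polyCN, polyCM); ring.
  rewrite eX; move: (c0) (c1) (c2) (c3) (c4) => d0 d1 d2 d3 d4.
  by ring.
have cf k := congr1 (fun p : {poly F} => p`_k) ePoly.
have := (cf 0%N, cf 1%N, cf 2%N, cf 3%N, cf 4%N).
rewrite !coef_Poly /= => -[[[[/oppr_inj h5 h4] /oppr_inj h3] h2] /oppr_inj h1].
by split.
Qed.

(** The radius is 1 here, so the squared diameter is 4. In terms of the symmetric functions [t] both
    claims are polynomial identities. *)
Lemma circle_zero (x0 : F) :
    x0 = - (q0 + q1 + q2 + q3 + q4 - (q0^-1 + q1^-1 + q2^-1 + q3^-1 + q4^-1)) ^+ 2 ->
  fA x0 (elsym y 5%N) 4 = 0 /\ fB x0 (elsym y 5%N) 4 = 0.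
Proof.
move=> ex0.
have nz : [&& q0 != 0, q1 != 0, q2 != 0, q3 != 0 & q4 != 0].
  have : q0 * q1 * q2 * q3 * q4 != 0 by rewrite prod_q oppr_eq0 oner_eq0.
  by rewrite !mulf_eq0 !negb_or -!andbA.
case/and5P: nz => nz0 nz1 nz2 nz3 nz4.
(* As the product of the [q i] is -1, the sum of their inverses is [- t 4]. *)
have {}ex0 : x0 = - (t 1%N + t 4%N) ^+ 2.
  rewrite ex0 /t; case: (elsym5 q) => -> _ _ -> _; rewrite /q /=.
  congr (- _ ^+ 2); congr (_ + _).
  apply: (mulfI (_ : q0 * q1 * q2 * q3 * q4 != 0)).
    by rewrite prod_q oppr_eq0 oner_eq0.
  rewrite [RHS](_ : _ = - (q0 * q1 * q2 * q3 + q0 * q1 * q2 * q4 + q0 * q1 * q3 * q4 + q0 * q2 * q3 * q4 + q1 * q2 * q3 * q4)); last by rewrite prod_q; ring.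
  by field; rewrite nz0 nz1 nz2 nz3 nz4.
have [e1 e2 e3 e4 e5] := elsym_circle.
rewrite ex0 /fA /fB /fT3 /fT4 /fT2 e1 e2 e3 e4 e5.
by move: (t 1%N) (t 2%N) (t 3%N) (t 4%N) => *; split; ring.
Qed.

Lemma heron_res_circle (x0 : F) :
    25%:R != 0 :> F -> 9%:R != 0 :> F ->
    x0 = - (q0 + q1 + q2 + q3 + q4 - (q0^-1 + q1^-1 + q2^-1 + q3^-1 + q4^-1)) ^+ 2 ->
  heron_res x0 (elsym (fun k => 2 - nth 0 [:: q0; q1; q2; q3; q4] k
                           - (nth 0 [:: q0; q1; q2; q3; q4] k)^-1) 5) = 0.
Proof. by move=> nz25 nz9 /circle_zero[]; apply: heron_res_common_root. Qed.

End UnitCircle.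

(** * Plane hexagons in complex coordinates *)

Lemma dist_sqr (R : realType) (p q : R * R) :
  dist p q ^+ 2 = (p.1 - q.1) ^+ 2 + (p.2 - q.2) ^+ 2.
Proof. by rewrite /dist sqr_sqrtr // addr_ge0 // sqr_ge0. Qed.

Lemma sum_ordS_sub (V : zmodType) n (g : 'I_n.+1 -> V) :
  \sum_i (g (ordS i) - g i) = 0.
Proof.
by rewrite sumrB [X in _ - X](reindex_inj (@ordS_inj n.+1)) subrr.
Qed.

Lemma signed_area_cross (R : realType) n (v : 'I_n.+1 -> R * R) (c : R * R) :
  signed_area v *+ 2 = \sum_i (((v i).1 - c.1) * ((v (ordS i)).2 - c.2)
                             - ((v (ordS i)).1 - c.1) * ((v i).2 - c.2)).
Proof.
apply/eqP; rewrite -subr_eq0 /signed_area -sumrMnl -sumrB.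
(* Termwise, the shoelace sum about [c] differs from twice the line integral by increments of [g],
   which cancel around the polygon. *)
pose g i := (v i).1 * (v i).2 + c.1 * (v i).2 - c.2 * (v i).1.
apply/eqP; transitivity (\sum_i (g (ordS i) - g i)); last exact: sum_ordS_sub.
apply: eq_bigr => i _; rewrite /g.
by rewrite -mulr_natr; field.
Qed.

Lemma vanishes_hexagon (R : realType) (P : {mpoly int[6]}) :
  heron_res_int = 256%:R * P -> vanishes_on_semicyclic R P.
Proof.
move=> res_P v j [c [r [r_gt0 cyc diam]]].
set h := fun i : 'I_6 => _; pose ev := mmap intr h.
have nz256 : 256%:R != 0 :> R by rewrite pnatr_eq0.
apply: (mulfI nz256); rewrite mulr0.
transitivity (ev heron_res_int); first by rewrite res_P /ev rmorphM rmorph_nat.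
pose y k := side_length v (lift j (inord k)) ^+ 2.
transitivity (heron_res (16 * signed_area v ^+ 2) (elsym y 5)).
  transitivity (heron_res (ev 'X_ord0) (ev \o elsym (@xside int) 5)); first exact: heron_res_morph.
  rewrite (_ : ev 'X_ord0 = 16 * signed_area v ^+ 2); last first.
    by rewrite /ev mmapX mmap1U /h unlift_none.
  apply: eq_heron_res => k _; rewrite /= [LHS]elsym_morph; apply: eq_elsym => i i5.
  rewrite /= /xside -[LHS]/(ev _) /ev mmapX mmap1U (inord_lift (Ordinal i5)) /h liftK.
  by rewrite /y; congr (side_length v (lift j _) ^+ 2); apply: val_inj; rewrite /= inordK.
pose f : {rmorphism R -> R[i]} := real_complex R; pose I : R[i] := Complex 0 1.
have I2 : I * I = -1 by apply/eqP; rewrite eq_complex /=; apply/andP; split; apply/eqP; ring.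
pose X i := f ((v i).1 - c.1); pose Y i := f ((v i).2 - c.2).
(* The vertex seen from the centre as a complex number, and its conjugate. *)
pose u i := X i + I * Y i; pose w i := X i - I * Y i.
pose r2 := f (r ^+ 2).
have uw i : u i * w i = r2.
  rewrite /r2 -(cyc i) dist_sqr rmorphD !rmorphXn /= -/(X i) -/(Y i).
  transitivity (X i ^+ 2 - I * I * Y i ^+ 2); first by rewrite /u /w; ring.
  by rewrite I2; ring.
have r2_nz : r2 != 0 by rewrite fmorph_eq0 expf_neq0 // gt_eqF.
have u_nz i : u i != 0 by have := r2_nz; rewrite -(uw i) mulf_eq0 negb_or => /andP[].
pose q i := u (ordS i) / u i.
have q_nz i : q i != 0 by rewrite mulf_neq0 ?invr_eq0.
have w_u i : w i = r2 / u i by rewrite -(uw i) mulrC mulKf.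
have side i : f (side_length v i ^+ 2) = r2 * (2 - q i - (q i)^-1).
  rewrite /side_length dist_sqr.
  transitivity ((u (ordS i) - u i) * (w (ordS i) - w i)).
    transitivity ((X (ordS i) - X i) ^+ 2 - I * I * (Y (ordS i) - Y i) ^+ 2).
      by rewrite I2 /X /Y; ring.
    by rewrite /u /w; ring.
  by rewrite !w_u /q; field; rewrite !u_nz.
have cross i : 2 * I * (X i * Y (ordS i) - X (ordS i) * Y i) = r2 * (q i - (q i)^-1).
  transitivity (u (ordS i) * w i - u i * w (ordS i)); first by rewrite /u /w; ring.
  by rewrite !w_u /q; field; rewrite !u_nz.
have qj : q j = -1.
  apply: (mulIf (u_nz j)); rewrite mulN1r divfK // /u /X /Y.
  have [dx dy] : (v (ordS j)).1 - c.1 = - ((v j).1 - c.1) /\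
                 (v (ordS j)).2 - c.2 = - ((v j).2 - c.2).
    move: diam => /(congr1 (fun p => (p.1, p.2))) /= [d1 d2]; split; lra.
  by rewrite dx dy !rmorphN /=; ring.
pose Q k := q (lift j (inord k)).
have Qk (k : 'I_5) : q (lift j k) = Q k by rewrite /Q inord_val.
(* The product of all six quotients telescopes to 1, and the diameter accounts for a factor -1. *)
have prodQ : Q 0%N * Q 1%N * Q 2%N * Q 3%N * Q 4%N = -1.
  have : \prod_i q i = 1.
    transitivity (\prod_i u (ordS i) / \prod_i u i); first exact: prodf_div.
    rewrite [X in _ / X](reindex_inj (@ordS_inj 6)) divff //.
    by apply/prodf_neq0.
  rewrite (bigD1_ord j) //= qj.
  under eq_bigr => k _ do rewrite Qk.
  rewrite !big_ord_recr big_ord0 /= mul1r => e.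
  by apply: oppr_inj; rewrite opprK -e mulN1r.
pose x0' := - (\sum_(k < 5) (Q k - (Q k)^-1)) ^+ 2.
have area : f (16 * signed_area v ^+ 2) = r2 ^+ 2 * x0'.
  (* The diameter contributes nothing to the area sum, since -1 is its own inverse. *)
  have a1 : 2 * I * f (signed_area v *+ 2) = r2 * \sum_(k < 5) (Q k - (Q k)^-1).
    rewrite (signed_area_cross v c) rmorph_sum mulr_sumr.
    transitivity (\sum_i r2 * (q i - (q i)^-1)).
      by apply: eq_bigr => i _; rewrite -cross /X /Y; ring.
    rewrite (bigD1_ord j) //= qj invrN1 subrr mulr0 add0r mulr_sumr.
    by apply: eq_bigr => k _; rewrite Qk.
  rewrite /x0' mulrN -exprMn -a1 rmorphM rmorphXn rmorph_nat rmorphMn.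
  transitivity (- (I * I) * 16 * f (signed_area v) ^+ 2); first by rewrite I2; ring.
  by ring.
have ex0 : x0' = - (Q 0%N + Q 1%N + Q 2%N + Q 3%N + Q 4%N
    - ((Q 0%N)^-1 + (Q 1%N)^-1 + (Q 2%N)^-1 + (Q 3%N)^-1 + (Q 4%N)^-1)) ^+ 2.
  rewrite /x0' !big_ord_recr big_ord0 /=.
  by move: (Q 0%N)^-1 (Q 1%N)^-1 (Q 2%N)^-1 (Q 3%N)^-1 (Q 4%N)^-1 => *; ring.
have nz k : k.+1%:R != 0 :> R[i] by rewrite pnatr_eq0.
(* Homogeneity in [r2] reduces the claim to the unit circle. *)
apply: (fmorph_inj f); rewrite heron_res_morph rmorph0 area.
pose Qs := nth 0 [:: Q 0%N; Q 1%N; Q 2%N; Q 3%N; Q 4%N].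
rewrite (@eq_heron_res _ _ _ (fun k => r2 ^+ k * elsym (fun k => 2 - Qs k - (Qs k)^-1) 5 k)).
  by rewrite (heron_res_weight _ _ r2_nz) (heron_res_circle prodQ (nz 24%N) (nz 8%N) ex0) mulr0.
move=> k _; rewrite /= [LHS]elsym_morph -elsym_weight.
apply: eq_elsym => i i5; rewrite /= /y side; congr (_ * _).
by case: i i5 => [|[|[|[|[|i]]]]].
Qed.

(** * A specialisation that is irreducible modulo 11 *)

(* A list of 15 digits modulo 11 stands for an element of F_11[z], where
   z^15 is given by the list gmod.  The lists gmod and dmod come from the
   specialisation x = (1, 2, 4, 7, 9): z is a root of alpha'_5 and dmod is the
   corresponding value of D = 4 r^2. *)
Definition gmod := [:: 2; 1; 4; 5; 9; 0; 10; 6; 0; 3; 4; 9; 2; 2; 6]%N.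
Definition dmod := [:: 10; 8; 10; 8; 5; 10; 8; 7; 10; 3; 1; 4; 9; 1; 3]%N.

Definition add15 (a b : seq nat) : seq nat :=
  mkseq (fun i => (nth 0 a i + nth 0 b i) %% 11)%N 15.
Definition scale15 (c : nat) (a : seq nat) : seq nat :=
  mkseq (fun i => (c * nth 0 a i) %% 11)%N 15.
(** Multiplication by z: the coefficient pushed to z^15 is folded back through [gmod]. *)
Definition shift15 (a : seq nat) : seq nat :=
  mkseq (fun i => ((if i is i'.+1 then nth 0 a i' else 0)
                   + nth 0 a 14 * nth 0 gmod i) %% 11)%N 15.
(** Horner's scheme in z along the first factor. *)
Definition mul15 (a b : seq nat) : seq nat :=
  foldr (fun c acc => add15 (scale15 c b) (shift15 acc)) [::] a.
Definition frob15 (a : seq nat) : seq nat :=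
  let a2 := mul15 a a in let a4 := mul15 a2 a2 in
  let a5 := mul15 a a4 in mul15 a (mul15 a5 a5).

(** Syntax for proof by reflection: [norm15] computes with digit lists, [sem15] interprets in a
    ring, and [eval15_norm] relates the two. *)
Inductive expr15 :=
  | Const15 of nat | Z15 | D15 | Opp15 of expr15
  | Add15 of expr15 & expr15 | Mul15 of expr15 & expr15.

Fixpoint norm15 (e : expr15) : seq nat :=
  match e with
  | Const15 n => mkseq (fun i => if i is 0 then n %% 11 else 0)%N 15
  | Z15 => [:: 0; 1]%N
  | D15 => dmod
  | Opp15 e => scale15 10 (norm15 e)
  | Add15 e1 e2 => add15 (norm15 e1) (norm15 e2)
  | Mul15 e1 e2 => mul15 (norm15 e1) (norm15 e2)
  end.

Section Eval15.
Variables (L : comNzRingType) (z : L).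

Definition eval15 (a : seq nat) : L := \sum_(i < 15) (nth 0%N a i)%:R * z ^+ i.

Hypothesis char11 : 11%:R = 0 :> L.
Hypothesis z15 : z ^+ 15 = eval15 gmod.

Let natr_mod n : (n %% 11)%N%:R = n%:R :> L.
Proof. by rewrite [in RHS](divn_eq n 11) natrD natrM char11 mulr0 add0r. Qed.

Lemma eval15_mkseq (h : nat -> nat) :
  eval15 (mkseq (fun i => h i %% 11)%N 15) = \sum_(i < 15) (h i)%:R * z ^+ i.
Proof. by apply: eq_bigr => i _; rewrite nth_mkseq // natr_mod. Qed.

Lemma eval15_add a b : eval15 (add15 a b) = eval15 a + eval15 b.
Proof.
rewrite eval15_mkseq -big_split; apply: eq_bigr => i _.
by rewrite natrD mulrDl.
Qed.

Lemma eval15_scale c a : eval15 (scale15 c a) = c%:R * eval15 a.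
Proof.
rewrite eval15_mkseq mulr_sumr; apply: eq_bigr => i _.
by rewrite natrM mulrA.
Qed.

Lemma eval15_shift a : eval15 (shift15 a) = z * eval15 a.
Proof.
rewrite eval15_mkseq.
under eq_bigr => i _ do rewrite natrD natrM mulrDl -mulrA.
rewrite big_split /= -mulr_sumr -/(eval15 gmod) -z15 big_ord_recl mul0r add0r.
rewrite /eval15 [in RHS]big_ord_recr mulrDr /= mulr_sumr; congr (_ + _).
  by apply: eq_bigr => i _; rewrite /bump add1n exprS mulrCA.
by rewrite exprS mulrCA.
Qed.

Lemma eval15_cons c a : (size a <= 14)%N -> eval15 (c :: a) = c%:R + z * eval15 a.
Proof.
move=> sa; rewrite /eval15 big_ord_recl expr0 mulr1; congr (_ + _).
rewrite [in RHS]big_ord_recr /= (nth_default _ sa) mul0r addr0 mulr_sumr.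
by apply: eq_bigr => i _; rewrite /bump add1n exprS mulrCA.
Qed.

Lemma eval15_mul a b : (size a <= 15)%N -> eval15 (mul15 a b) = eval15 a * eval15 b.
Proof.
elim: a => [|c a IHa] sa.
  suff -> : eval15 [::] = 0 by rewrite mul0r.
  by rewrite /eval15 big1 // => i _; rewrite nth_nil mul0r.
by rewrite eval15_add eval15_scale eval15_shift IHa 1?ltnW // eval15_cons //; ring.
Qed.

Lemma size_mul15 a b : (size (mul15 a b) <= 15)%N.
Proof. by case: a => //= c a; rewrite size_mkseq. Qed.

Lemma eval15_frob a : (size a <= 15)%N -> eval15 (frob15 a) = eval15 a ^+ 11.
Proof. by move=> sa; rewrite !eval15_mul ?size_mul15 //; ring. Qed.

Lemma size_frob15 a : (size (frob15 a) <= 15)%N.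
Proof. exact: size_mul15. Qed.

Lemma eval15_Z : eval15 [:: 0; 1]%N = z.
Proof. by rewrite /eval15 !big_ord_recl big_ord0 /=; ring. Qed.

Lemma eval15_iter k :
  eval15 (iter k frob15 [:: 0; 1]%N) = z ^+ (11 ^ k).
Proof.
have sz j : (size (iter j frob15 [:: 0; 1]%N) <= 15)%N.
  by case: j => //= j; apply: size_frob15.
elim: k => [|k IHk]; first by rewrite eval15_Z expr1.
by rewrite iterS eval15_frob // IHk -exprM -expnSr.
Qed.

Fixpoint sem15 (e : expr15) : L :=
  match e with
  | Const15 n => n%:R
  | Z15 => z
  | D15 => eval15 dmod
  | Opp15 e => - sem15 e
  | Add15 e1 e2 => sem15 e1 + sem15 e2
  | Mul15 e1 e2 => sem15 e1 * sem15 e2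
  end.

Lemma size_norm15 e : (size (norm15 e) <= 15)%N.
Proof. by elim: e => //= *; rewrite ?size_mkseq ?size_mul15. Qed.

Lemma eval15_norm e : eval15 (norm15 e) = sem15 e.
Proof.
elim: e => [n|||e IH|e1 IH1 e2 IH2|e1 IH1 e2 IH2] //=; last 1 first.
- by rewrite eval15_mul ?size_norm15 // IH1 IH2.
- rewrite /eval15 big_ord_recl big1 => [|i _].
    by rewrite nth_mkseq //= natr_mod mulr1 addr0.
  by rewrite nth_mkseq ?ltn_ord //= mul0r.
- exact: eval15_Z.
- rewrite eval15_scale IH (_ : 10%:R = -1) ?mulN1r //.
  by apply/eqP; rewrite -subr_eq0 opprK -(natrD _ 10 1) char11.
- by rewrite eval15_add IH1 IH2.
Qed.

Lemma sem15_eq0 e : all (eqn 0) (norm15 e) -> sem15 e = 0.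
Proof.
move=> /all_nthP z0; rewrite -eval15_norm /eval15 big1 // => i _.
case: (ltnP i (size (norm15 e))) => [lt|ge]; last by rewrite nth_default ?mul0r.
by rewrite -(eqnP (z0 0%N i lt)) mul0r.
Qed.

(* The elementary symmetric functions of (1, 2, 4, 7, 9). *)
Definition point_sym (k : nat) : nat := nth 0%N [:: 1; 23; 189; 673; 1010; 504]%N k.

(** Both polynomials are written as [expr15] trees whose normal forms are computed to be zero. *)
Lemma common_root15 :
  fA z (fun k => (point_sym k)%:R) (eval15 dmod) = 0 /\
  fB z (fun k => (point_sym k)%:R) (eval15 dmod) = 0.
Proof.
pose s k := Const15 (point_sym k); pose C := Const15.
pose sq e := Mul15 e e; pose sub a b := Add15 a (Opp15 b).
pose T2 := Add15 (sub (sub (Add15 (sq (s 1)) (Mul15 (Mul15 (C 2) (s 1)) D15))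
   (Mul15 (C 3) (sq D15))) (Mul15 (C 4) (s 2))) Z15.
pose T3 := sub (Add15 (Mul15 (C 8) (s 3)) (Mul15 (Add15 (s 1) D15) T2))
   (Mul15 (Mul15 (C 2) D15) (sq (sub (s 1) D15))).
pose T4 := sub (sub (sq T2) (Mul15 (Mul15 (Mul15 (C 8) D15) (sub (s 1) D15)) T2))
   (Mul15 (C 64) (s 4)).
pose A := Add15 (sq T3) (Mul15 Z15 T4).
pose B := sub (Mul15 (C 64) (s 5)) (Mul15 D15 (sq T2)).
have HA : sem15 A = 0 by apply: sem15_eq0; vm_compute.
have HB : sem15 B = 0 by apply: sem15_eq0; vm_compute.
by split; [rewrite -HA | rewrite -HB]; rewrite /fA /fB /fT3 /fT4 /fT2 /=.
Qed.

End Eval15.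

(** * Irreducibility of the polynomial of degree 15 over the field with 11 elements *)

Lemma irreducible_factor (F : fieldType) (d : {poly F}) :
  (1 < size d)%N -> exists2 p, irreducible_poly p & p %| d.
Proof.
have [n] := ubnP (size d); elim: n d => // n IHn d sd d1.
have [irr|nirr] := pselect (irreducible_poly d); first by exists d.
have [q [q1 qd nqd]] : exists q : {poly F}, [/\ size q != 1%N, q %| d & ~~ (q %= d)].
  apply: contrapT => H; apply: nirr; split => // q q1 qd.
  by apply: contrapT => /negP nqd; apply: H; exists q.
have d0 : d != 0 by rewrite -size_poly_gt0 ltnW.
have q0 : q != 0 by apply: contraNneq d0 => q0; move: qd; rewrite q0 dvd0p.
have sq : (size q < size d)%N by rewrite ltn_neqAle dvdp_size_eqp // nqd dvdp_leq.
have [||p irr pq] := IHn q; first exact: leq_trans sq _.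
  by rewrite ltn_neqAle eq_sym q1 size_poly_gt0.
by exists p => //; apply: dvdp_trans pq qd.
Qed.

Definition poly15 : {poly 'F_11} := 'X^15 - \sum_(i < 15) (nth 0%N gmod i)%:R *: 'X^i.

Lemma char11_alg (L : fieldExtType 'F_11) : 11%:R = 0 :> L.
Proof. by rewrite -(rmorph_nat (in_alg L)) (_ : 11%:R = 0 :> 'F_11) ?rmorph0 //; apply/eqP. Qed.

Lemma root_poly15 (L : fieldExtType 'F_11) (z : L) :
  root (map_poly (in_alg L) poly15) z -> z ^+ 15 = eval15 z gmod.
Proof.
rewrite rootE /poly15 rmorphB rmorph_sum /= map_polyXn hornerD hornerN hornerXn subr_eq0 => /eqP->.
rewrite horner_sum; apply: eq_bigr => i _.
by rewrite map_polyZ map_polyXn hornerZ hornerXn rmorph_nat.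
Qed.

(** An extension of degree d has 11^d elements, so raising to the power 11^d fixes all of them, and
    so do the iterates of this map. *)
Lemma frob_fixed (L : fieldExtType 'F_11) (z : L) k :
  (\dim {:L} %| k)%N -> z ^+ (11 ^ k) = z.
Proof.
move=> /dvdnP[m ->]; rewrite mulnC expnM.
have e : z ^+ (11 ^ \dim {:L}) = z.
  have cardL : #|finvect_type L| = (11 ^ \dim {:L})%N.
    pose V : {vspace finvect_type L} := fullv.
    transitivity #|V|; first by apply: eq_card => x; rewrite memvf.
    by rewrite card_vspace card_Fp.
  by have := expf_card (z : finvect_type L); rewrite cardL.
by elim: m => [|m IHm]; rewrite ?expr1 // expnS exprM e.
Qed.

(** Each [k] is paired with the inverse of [z^(11^k) - z] modulo [poly15]. *)
Definition inv15 : seq (nat * seq nat) :=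
  [:: (4, [:: 6; 1; 6; 1; 8; 3; 3; 6; 8; 5; 3; 0; 5; 7; 5]);
      (5, [:: 9; 10; 3; 3; 4; 6; 0; 7; 8; 1; 4; 8; 3; 7; 7]);
      (6, [:: 2; 4; 8; 9; 5; 4; 10; 8; 3; 2; 7; 2; 8; 0; 9]);
      (7, [:: 4; 3; 0; 7; 8; 5; 6; 4; 8; 7; 2; 3; 1; 0; 4])]%N.

(* z^(11^k) - z is invertible modulo poly15 for k = 4, 5, 6, 7, which excludes
   every irreducible factor whose degree divides one of these k. *)
Lemma inv15_check :
  all (fun kv => (size kv.2 <= 15)
    && (mul15 kv.2 (add15 (iter kv.1 frob15 [:: 0; 1]) [:: 0; 10])
        == 1 :: nseq 14 0))%N inv15.
Proof. by vm_compute. Qed.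

Lemma size_poly15 : size poly15 = 16%N.
Proof.
rewrite /poly15 size_polyDl ?size_polyXn // size_polyN ltnS.
apply: leq_trans (size_sum _ _ _) _; apply/bigmax_leqP => i _.
by rewrite (leq_trans (size_scale_leq _ _)) // size_polyXn.
Qed.

(** A proper factorisation would yield an irreducible factor of degree at most 7. Each of 1, ..., 7
    divides one of 4, 5, 6, 7, so a root z of that factor would satisfy z^(11^k) = z for such a k,
    against [inv15_check]. *)
Lemma poly15_irreducible : irreducible_poly poly15.
Proof.
have f0 : poly15 != 0 by rewrite -size_poly_gt0 size_poly15.
have small p : irreducible_poly p -> p %| poly15 -> (size p <= 8)%N -> False.
  move=> irr pf sp; have [L dL [z rz _]] := irredp_FAdjoin irr.
  have ch := char11_alg L.
  have z15 : z ^+ 15 = eval15 z gmod.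
    apply: root_poly15; case/dvdpP: pf => q ->.
    by rewrite rmorphM rootM rz orbT.
  have dim_gt0 : (0 < \dim {:L})%N by rewrite dL; case: irr; case: (size p) => [|[|k]].
  have bad kv : kv \in inv15 -> (\dim {:L} %| kv.1)%N -> False.
    move=> /(allP inv15_check) /andP[sv /eqP/(congr1 (eval15 z)) e] dv.
    move: e; rewrite eval15_mul // eval15_add // eval15_iter // frob_fixed //.
    rewrite [X in z + X](_ : _ = 11%:R * z - z).
      rewrite ch mul0r sub0r subrr mulr0 => /eqP.
      by rewrite /eval15 !big_ord_recl big_ord0 /= !mul0r !addr0 mul1r expr0 eq_sym oner_eq0.
    by rewrite /eval15 !big_ord_recl big_ord0 /=; ring.
  have dn : \dim {:L} \in [:: 1; 2; 3; 4; 5; 6; 7]%N.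
    by rewrite dL in dim_gt0 *; move: (size p) dim_gt0 sp => [|[|[|[|[|[|[|[|[|n]]]]]]]]].
  have : has (fun kv => \dim {:L} %| kv.1)%N inv15.
    by move: dn; move: (\dim {:L}); apply/allP.
  by case/hasP => kv; apply: bad.
split; first by rewrite size_poly15.
move=> q q1 qf; apply: contrapT => nqf.
have q0 : q != 0 by apply: contraNneq f0 => q0; move: qf; rewrite q0 dvd0p.
have sq : (size q < 16)%N.
  by rewrite ltn_neqAle -size_poly15 dvdp_size_eqp // dvdp_leq // andbT; apply/negP.
have q2 : (1 < size q)%N by rewrite ltn_neqAle eq_sym q1 size_poly_gt0.
have [r fr] : exists r, poly15 = r * q by apply/dvdpP.
have r0 : r != 0 by apply: contraNneq f0 => r0; rewrite fr r0 mul0r.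
have sr := size_poly15; rewrite fr size_mul // in sr.
have [le8|gt8] := leqP (size q) 8.
  have [p irr pq] := irreducible_factor q2.
  by apply: (small p irr (dvdp_trans pq qf)); apply: leq_trans (dvdp_leq q0 pq) le8.
have r2 : (1 < size r)%N by lia.
have [p irr pr] := irreducible_factor r2.
have rf : r %| poly15 by rewrite fr dvdp_mulr.
by apply: (small p irr (dvdp_trans pr rf)); apply: leq_trans (dvdp_leq r0 pr) _; lia.
Qed.

(** * Irreducibility *)

Section InFirst.
Variable n : nat.

Let inF : {rmorphism {mpoly int[n.+1]} -> {poly {mpoly int[n]}}} :=
  mmap (@polyC {mpoly int[n]} \o @mpolyC n int)
    (fun i => if unlift ord0 i is Some j then ('X_j)%:P else 'X).

Fact in_first_zmod_morphism : zmod_morphism (@in_first n).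
Proof. exact: (rmorphB inF). Qed.

Fact in_first_monoid_morphism : monoid_morphism (@in_first n).
Proof. by split; [exact: (rmorph1 inF) | exact: (rmorphM inF)]. Qed.

HB.instance Definition _ := GRing.isZmodMorphism.Build _ _ (@in_first n)
  in_first_zmod_morphism.
HB.instance Definition _ := GRing.isMonoidMorphism.Build _ _ (@in_first n)
  in_first_monoid_morphism.

Lemma in_firstX0 : in_first ('X_ord0 : {mpoly int[n.+1]}) = 'X.
Proof. by rewrite -[LHS]/(mmap (@polyC {mpoly int[n]} \o @mpolyC n int) _ _) mmapX mmap1U unlift_none. Qed.

Lemma in_firstX i : in_first ('X_(lift ord0 i) : {mpoly int[n.+1]}) = ('X_i)%:P.
Proof. by rewrite -[LHS]/(mmap (@polyC {mpoly int[n]} \o @mpolyC n int) _ _) mmapX mmap1U liftK. Qed.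

End InFirst.

Definition lift_vars n : {mpoly int[n]} -> {mpoly int[n.+1]} :=
  mmap (@mpolyC n.+1 int) (fun i => 'X_(lift ord0 i)).
HB.instance Definition _ n := GRing.RMorphism.on (@lift_vars n).

Lemma lift_varsX n i : lift_vars 'X_i = 'X_(lift ord0 i) :> {mpoly int[n.+1]}.
Proof. by rewrite /lift_vars mmapX mmap1U. Qed.

Lemma rmorph_in_first (S : comNzRingType) n
    (g : {rmorphism {mpoly int[n.+1]} -> S}) (h : {rmorphism {mpoly int[n]} -> S}) Q :
  (forall i, h 'X_i = g 'X_(lift ord0 i)) ->
  g Q = (map_poly h (in_first Q)).[g 'X_ord0].
Proof.
move=> hg; pose k := horner_eval (g 'X_ord0) \o map_poly h \o @in_first n.
rewrite -[RHS]/(k Q); apply: mpoly_int_morph_eq => i; rewrite /k /= /horner_eval.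
case: (unliftP ord0 i) => [j|] ->; rewrite ?in_firstX ?in_firstX0.
  by rewrite map_polyC hornerC -hg.
by rewrite map_polyX hornerX.
Qed.

Lemma in_firstK n (Q : {mpoly int[n.+1]}) :
  Q = (map_poly (@lift_vars n) (in_first Q)).['X_ord0].
Proof. by apply: (@rmorph_in_first _ _ idfun) => i; exact: lift_varsX. Qed.

Lemma in_first_inj n : injective (@in_first n).
Proof. by move=> p q e; rewrite [p]in_firstK [q]in_firstK e. Qed.

Lemma horner_nz_ex (S : idomainType) (p : {poly S}) (f : nat -> S) :
  p != 0 -> injective f -> exists k, p.[f k] != 0.
Proof.
move=> p0 fi; apply: contrapT => H.
have rt : all (root p) [seq f i | i <- iota 0 (size p)].
  apply/allP => _ /mapP[k _ ->]; apply: contrapT => /negP; rewrite rootE => nz.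
  by apply: H; exists k.
have := max_poly_roots p0 rt; rewrite map_inj_uniq // iota_uniq => /(_ isT).
by rewrite size_map size_iota ltnn.
Qed.

(** Induction on the number of variables: a point where the leading coefficient in the first
    variable does not vanish leaves a nonzero univariate polynomial, which has a nonroot in any
    infinite progression. *)
Lemma meval_nz_ex n (h : {mpoly int[n]}) (c : nat -> nat) m : h != 0 ->
  exists x : 'I_n -> nat, (forall i, (0 < x i)%N /\ x i = c i %[mod m.+1])
    /\ h.@[fun i => (x i)%:R] != 0.
Proof.
elim: n h c => [|n IHn] h c h0.
  exists (fun _ => 0%N); split; first by case.
  have e : h = (h@_0)%:MP by rewrite mpolyKC.
  by apply: contraNneq h0; rewrite e mevalC => ->; rewrite mpolyC0.
have l0 : lead_coef (in_first h) != 0.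
  by rewrite lead_coef_eq0 -(rmorph0 (@in_first n)) (inj_eq (@in_first_inj n)).
have [x' [x'c x'0]] := IHn _ (fun i => c i.+1) l0.
pose p := map_poly (meval (fun i => (x' i)%:R : int)) (in_first h).
have p0 : p != 0.
  apply: contraNneq x'0 => p0; rewrite lead_coefE -coef_map -/p p0 coef0 //.
(* Using [k.+1] keeps the value positive even when [c 0] is zero. *)
pose f k : int := (c 0 + m.+1 * k.+1)%N%:R.
have [|k pk] := @horner_nz_ex _ p f p0.
  move=> i j /eqP; rewrite /f eqr_nat eqn_add2l eqn_pmul2l // eqSS => /eqP //.
exists (fun i => if unlift ord0 i is Some j then x' j else (c 0 + m.+1 * k.+1)%N).
split.
  move=> i; case: (unliftP ord0 i) => [j|] ->; rewrite ?liftK ?unlift_none.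
    have [pos e] := x'c j; split => //; rewrite e /= /bump add1n //.
  split; first by rewrite addnC ltn_addr // muln_gt0.
  by rewrite /= mulnC addnC modnMDl.
have -> := @rmorph_in_first _ _ (meval _) (meval (fun i => (x' i)%:R)) h.
  rewrite /= mevalXU unlift_none //.
by move=> i; rewrite /= !mevalXU liftK.
Qed.

Definition base_pt (i : nat) : nat := nth 0%N [:: 1; 2; 4; 7; 9]%N i.

Lemma point_symE k : (0 < k <= 5)%N ->
  elsym (fun i => (base_pt i)%:R : int) 5 k = (point_sym k)%:R.
Proof. by case: k => [|[|[|[|[|[|k]]]]]] // _; cbv [elsym]; apply/eqP; vm_compute. Qed.

Definition spec (x : 'I_5 -> nat) : {mpoly int[6]} -> {poly int} :=
  map_poly (meval (fun i => (x i)%:R)) \o @in_first 5.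
HB.instance Definition _ x := GRing.RMorphism.on (spec x).

Definition mod11 : {poly int} -> {poly 'F_11} := map_poly intr.
HB.instance Definition _ := GRing.RMorphism.on mod11.

Lemma size_map_monic (A B : nzRingType) (f : {rmorphism A -> B}) (p : {poly A}) :
  p \is monic -> size (map_poly f p) = size p.
Proof.
by move=> mp; rewrite size_map_poly_id0 // (monicP mp) rmorph1 oner_neq0.
Qed.

Section Irreducibility.
Variable P : {mpoly int[6]}.
Hypothesis res_P : heron_res_int = 256%:R * P.

Lemma size_in_firstE : size (in_first P) = 16%N.
Proof.
apply/eqP; rewrite eqn_leq (size_in_first res_P) ltnNge; apply/negP => /leq_sizeP le.
by have /eqP := le 15%N (leqnn _); rewrite (coef15_in_first res_P) oner_eq0.
Qed.

Lemma spec_monic x : spec x P \is monic.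
Proof. exact/monic_map/monic_in_first. Qed.

Lemma size_spec x : size (spec x P) = 16%N.
Proof. by rewrite /spec /= size_map_monic ?size_in_firstE ?monic_in_first. Qed.

Lemma size_mod11_spec x : size (mod11 (spec x P)) = 16%N.
Proof. by rewrite /mod11 size_map_monic ?size_spec ?spec_monic. Qed.

(** By [common_root15] a root of [poly15] is also a root of the specialisation. Since [poly15] is
    irreducible and both have degree 15, they are associates. *)
Lemma mod11_spec_irreducible (x : 'I_5 -> nat) :
  (forall i : 'I_5, x i = base_pt i %[mod 11]) -> irreducible_poly (mod11 (spec x P)).
Proof.
move=> xc; set p := mod11 _.
have [L _ [z rz _]] := irredp_FAdjoin poly15_irreducible.
have ch := char11_alg L.
have natr_mod n : (n %% 11)%N%:R = n%:R :> L.
  by rewrite [in RHS](divn_eq n 11) natrD natrM ch mulr0 add0r.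
have z15 := root_poly15 rz.
pose g := horner_eval z \o map_poly (in_alg L) \o mod11 \o spec x.
have gX0 : g 'X_ord0 = z.
  by rewrite /g /spec /mod11 /= in_firstX0 !map_polyX /horner_eval hornerX.
have gX (i : 'I_5) : g 'X_(lift ord0 i) = (base_pt i)%:R.
  rewrite /g /spec /mod11 /= in_firstX !map_polyC /horner_eval hornerC /=.
  by rewrite mevalXU /= !rmorph_nat ?scaler_nat -(natr_mod (x i)) xc natr_mod.
have pz : (map_poly (in_alg L) p).[z] = 0.
  have nz n : (n %% 11 != 0)%N -> n%:R != 0 :> L.
    move=> nn; rewrite -natr_mod -(rmorph_nat (in_alg L)) fmorph_eq0.
    rewrite -(dvdn_pcharf (pchar_Fp (isT : prime 11))) /dvdn modn_mod //.
  have nz256 : 256%:R != 0 :> L by apply: nz.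
  apply: (mulfI nz256); rewrite mulr0.
  transitivity (g heron_res_int); first by rewrite res_P /g rmorphM rmorph_nat.
  transitivity (heron_res (g 'X_ord0) (g \o elsym (@xside int) 5)); first exact: heron_res_morph.
  rewrite gX0 (@eq_heron_res _ _ _ (fun k => (point_sym k)%:R)); last first.
    move=> k kk; rewrite /= [LHS]elsym_morph -[RHS](rmorph_nat (intr : int -> L)) -point_symE //.
    rewrite [RHS]elsym_morph; apply: eq_elsym => i i5.
    by rewrite /= /xside (inord_lift (Ordinal i5)) -[LHS]/(g _) gX rmorph_nat.
  have [A0 B0] := common_root15 ch z15.
  by apply: heron_res_common_root A0 B0; apply: nz.
have ncop : ~~ coprimep poly15 p.
  apply/negP; rewrite -(coprimep_map (in_alg L)) => /coprimep_root/(_ rz).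
  by rewrite pz eqxx.
have [f1 firr] := poly15_irreducible.
have fp : poly15 %| p.
  have ge : gcdp poly15 p %= poly15 by apply: firr; rewrite ?dvdp_gcdl.
  by rewrite -(eqp_dvdl _ ge) dvdp_gcdr.
have p0 : p != 0 by rewrite -size_poly_gt0 size_mod11_spec.
have efp : poly15 %= p by rewrite -dvdp_size_eqp // size_poly15 size_mod11_spec.
split; first by rewrite size_mod11_spec.
move=> q q1 qp; apply: (eqp_trans _ efp); apply: firr => //.
by rewrite (eqp_dvdr _ efp).
Qed.

(** By Gauss's lemma a nonconstant common factor yields a divisor [p1] of [p] over the integers,
    with unit leading coefficient as [p] is monic. Its reduction modulo 11 keeps the degree and so
    has the full degree of [p], which exceeds that of [h]. *)
Lemma spec_resultant_neq0 (p h : {poly int}) :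
    p \is monic -> irreducible_poly (mod11 p) ->
    h != 0 -> (size h < size p)%N -> resultant p h != 0.
Proof.
move=> mp [_ irr] h0 sh.
have p0 := monic_neq0 mp.
rewrite resultant_eq0 -leqNgt leqNgt; apply/negP => sg.
set g := gcdp p h in sg.
have g_h : (size g <= size h)%N by rewrite dvdp_leq // dvdp_gcdr.
have gQ : map_poly intr g %| map_poly (intr : int -> rat) p.
  have /Pdiv.Idomain.dvdpP[[c q] /= c0 e] : g %| p by apply: dvdp_gcdl.
  have cQ : c%:~R != 0 :> rat by rewrite intr_eq0.
  rewrite -(dvdpZr _ _ cQ); apply/dvdpP; exists (map_poly intr q).
  by rewrite -rmorphM -e /= map_polyZ.
have [p1 [a a0 ea] [r er]] := dvdpP_rat_int gQ.
have szQ (u : {poly int}) : size (map_poly (intr : int -> rat) u) = size u.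
  by rewrite size_map_inj_poly // => i j /eqP; rewrite eqr_int => /eqP.
have sp1 : size p1 = size g by rewrite -szQ -[RHS]szQ ea size_scale.
have lu : lead_coef p1 \is a GRing.unit.
  by apply/unitrP; exists (lead_coef r); rewrite mulrC -lead_coefM -er (monicP mp).
have s11 : size (mod11 p1) = size p1.
  rewrite /mod11 size_map_poly_id0 //.
  have : ((lead_coef p1)%:~R : 'F_11) \is a GRing.unit by apply: rmorph_unit.
  by rewrite unitfE.
have d11 : mod11 p1 %| mod11 p by rewrite er rmorphM dvdp_mulr.
have /eqp_size e : mod11 p1 %= mod11 p.
  by apply: irr d11; rewrite s11 sp1 gtn_eqF.
have := leq_ltn_trans g_h sh; rewrite -sp1 -s11 e /mod11 size_map_monic //.
by rewrite ltnn.
Qed.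

End Irreducibility.

Lemma in_first_const n (b : {mpoly int[n.+1]}) (c : {mpoly int[n]}) :
  in_first b = c%:P -> b = lift_vars c.
Proof. by move=> e; rewrite [LHS]in_firstK e map_polyC hornerC. Qed.

Lemma size_in_first_unit n (b : {mpoly int[n.+1]}) :
  b \is a GRing.unit -> size (in_first b) = 1%N.
Proof.
move=> ub; have e : in_first b * in_first b^-1 = 1 by rewrite -rmorphM divrr ?rmorph1.
have := size_poly1 {mpoly int[n]}; rewrite -e => /eqP.
by rewrite size_mul_eq1 => /andP[/eqP].
Qed.

Lemma lead_coef_unit (A : idomainType) (p q : {poly A}) :
  p * q \is monic -> lead_coef p \is a GRing.unit.
Proof.
move=> /monicP; rewrite lead_coefM mulrC => e.
by apply/unitrP; exists (lead_coef q); split=> //; rewrite mulrC.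
Qed.

Lemma irreducible_mul_size (F : fieldType) (p q : {poly F}) :
  irreducible_poly (p * q) -> size p = 1%N \/ size q = 1%N.
Proof.
move=> [s1 irr]; have [sp|sp] := eqVneq (size p) 1%N; [by left | right].
have pq0 : p * q != 0 by rewrite -size_poly_gt0 ltnW.
have /andP[p0 q0] : (p != 0) && (q != 0) by move: pq0; rewrite mulf_eq0 negb_or.
have /eqp_size : p %= p * q by apply: irr sp _; apply: dvdp_mulr.
rewrite size_mul //; move: p0 q0; rewrite -!size_poly_gt0.
by case: (size p) => // k; case: (size q) => // l _ _; lia.
Qed.

Lemma map_poly_unit (A B : unitRingType) (f : {rmorphism A -> B}) (p : {poly A}) :
    lead_coef p \is a GRing.unit ->
  size (map_poly f p) = size p /\ lead_coef (map_poly f p) \is a GRing.unit.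
Proof.
move=> u; have fu : f (lead_coef p) \is a GRing.unit by apply: rmorph_unit.
have f0 : f (lead_coef p) != 0 by apply: contraTneq fu => ->; rewrite unitr0.
by rewrite size_map_poly_id0 // lead_coef_map_eq.
Qed.

(** Factors of a monic polynomial have unit leading coefficients, so specialisation and reduction
    modulo 11 preserve their degrees. One factor therefore has degree 0 in the first variable and
    equals its leading coefficient, a unit. *)
Lemma alpha_irreducible (P : {mpoly int[6]}) :
  heron_res_int = 256%:R * P -> irreducible_elt P.
Proof.
move=> res_P; have mP := monic_in_first res_P.
have sP := size_in_firstE res_P.
have P0 : P != 0 by apply: contraTneq mP => ->; rewrite rmorph0; apply/negP => /monic_neq0/eqP.
split=> //.
  by apply/negP => /size_in_first_unit; rewrite sP.
pose x (i : 'I_5) := base_pt i.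
have irr := mod11_spec_irreducible res_P (x := x) (fun _ => erefl).
have half b c : P = b * c -> size (mod11 (spec x b)) = 1%N -> b \is a GRing.unit.
  move=> e s1.
  have ub : lead_coef (in_first b) \is a GRing.unit.
    by apply: (@lead_coef_unit _ _ (in_first c)); rewrite -rmorphM -e.
  have sb : size (in_first b) = 1%N.
    have [s u] := map_poly_unit (meval (fun i => (x i)%:R)) ub.
    by rewrite -s -(map_poly_unit (intr : int -> 'F_11) u).1; apply: s1.
  have /size_poly1P[k _ ek] : size (in_first b) == 1%N by rewrite sb.
  rewrite (in_first_const ek); apply: rmorph_unit.
  by move: ub; rewrite ek lead_coefC.
move=> b c e.
have e11 : mod11 (spec x P) = mod11 (spec x b) * mod11 (spec x c).
  by rewrite e !rmorphM.
rewrite e11 in irr; case: (irreducible_mul_size irr) => s1.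
  by left; apply: half e s1.
by right; apply: (half c b) s1; rewrite mulrC.
Qed.

(** * Uniqueness *)

Definition hexagons (R : realType) := forall (a : 'I_4 -> R) (M : R),
  (forall i, 0 < a i) -> exists (v : 'I_6 -> R * R) (j : 'I_6),
  [/\ semicyclic v j, forall k, side_length v (lift j (lift ord0 k)) ^+ 2 = a k
    & M < side_length v (lift j ord0) ^+ 2].

Lemma unbounded_roots (R : rcfType) (p : {poly R}) :
  (forall M, exists2 y, M < y & p.[y] = 0) -> p = 0.
Proof.
move=> H; apply/eqP; apply: contrapT => /negP p0.
have [y My py] := H (cauchy_bound p).
have := lt_le_trans (cauchy_boundP p0 py) (ltW My).
by rewrite ltNge ler_norm.
Qed.

Lemma monic_division (A : nzRingType) (q p : {poly A}) : p \is monic ->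
  exists S T, q = S * p + T /\ (size T < size p)%N.
Proof.
move=> mp; exists (Pdiv.Ring.rdivp q p), (Pdiv.Ring.rmodp q p).
split; first exact: (Pdiv.RingMonic.rdivp_eq mp q).
by rewrite Pdiv.Ring.ltn_rmodp monic_neq0.
Qed.

Lemma alpha_unique (R : realType) (P Q : {mpoly int[6]}) :
    hexagons R -> heron_res_int = 256%:R * P -> vanishes_on_semicyclic R P ->
  is_alpha' R Q -> Q = P.
Proof.
move=> hex res_P vP [[Q0 Qnu Qirr] mQ _ vQ].
have mP := monic_in_first res_P; have sP := size_in_firstE res_P.
move Ep: (in_first P) mP sP => p mP sP; move Eq: (in_first Q) mQ => q mQ.
have [S [T [eq_q sT]]] := monic_division q mP; rewrite sP in sT.
have [T0|T0] := eqVneq T 0.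
  pose out : {rmorphism {poly {mpoly int[5]}} -> {mpoly int[6]}} :=
    horner_eval 'X_ord0 \o map_poly (@lift_vars 5).
  have outK W : out (in_first W) = W by rewrite [RHS]in_firstK.
  have eQ : Q = out S * P by rewrite -[Q]outK Eq eq_q T0 addr0 rmorphM -Ep outK.
  have [_ Pnu _] := alpha_irreducible res_P.
  have uS : out S \is a GRing.unit by case: (Qirr _ _ eQ) => // uP; case/negP: Pnu.
  have /eqP/size_poly1P[c _ ec] := size_in_first_unit uS.
  have q_cp : q = c%:P * p.
    transitivity (in_first (out S) * in_first P); last by rewrite ec Ep.
    by rewrite -rmorphM -eQ; apply: esym.
  have c1 : c = 1.
    by have := monicP mQ; rewrite q_cp lead_coef_Mmonic // lead_coefC.
  by apply: in_first_inj; rewrite Eq Ep q_cp c1 mul1r.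
exfalso.
have lT : lead_coef T != 0 by rewrite lead_coef_eq0.
(* The argument 10 stands for the modulus 11. *)
have [x [xc xT]] := meval_nz_ex base_pt 10 lT.
pose ex := meval (fun i => (x i)%:R : int).
have sTx : size (map_poly ex T) = size T by rewrite size_map_poly_id0.
have Tx0 : map_poly ex T != 0 by rewrite -size_poly_gt0 sTx size_poly_gt0.
(* An element of the ideal (p, T) free of the first variable: [T] itself if it is constant,
   otherwise the resultant. *)
have [g [[U [V eg]] gx]] : exists g, (exists U V, g%:P = U * p + V * T) /\ ex g != 0.
  have [s1|s1] := leqP (size T) 1.
    exists (lead_coef T); split=> //; exists 0, 1; rewrite mul0r add0r mul1r.
    by rewrite [in RHS](size1_polyC s1) lead_coefE; case: (size T) s1 => [|[|]].
  exists (resultant p T); split.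
    have sp1 : (1 < size p)%N by rewrite sP.
    by have [[U V] _ e] := resultant_in_ideal sp1 s1; exists U, V.
  have sT1 : size T = (size T).-1.+1 by rewrite (ltn_predK s1).
  (* With fixed formal degrees the resultant commutes with the specialisation, which preserves both
     degrees. *)
  rewrite (resultant_sres sP sT1) /ex sres_morph -/ex.
  have sPx : size (map_poly ex p) = 16%N by rewrite size_map_monic.
  rewrite -(resultant_sres (m := 15) (n := (size T).-1)) ?sTx //.
  apply: spec_resultant_neq0; rewrite ?sTx ?sPx //.
    exact: monic_map.
  rewrite -Ep; apply: (mod11_spec_irreducible res_P (x := x)) => i; by case: (xc i).
pose ev n (y : 'I_n -> R) : {rmorphism {mpoly int[n]} -> R} := mmap intr y.
have evX n (y : 'I_n -> R) i : ev n y 'X_i = y i by rewrite /ev /= mmapX mmap1U.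
pose a (i : 'I_4) : R := (x (lift ord0 i))%:R.
pose G := map_poly (ev 4 a) (in_first g).
have evG (y : 'I_5 -> R) : (forall i, y (lift ord0 i) = a i) -> ev 5 y g = G.[y ord0].
  move=> ya; rewrite (@rmorph_in_first _ _ (ev 5 y) (ev 4 a)) ?evX // => i.
  by rewrite !evX ya.
(* With four sides fixed, [G] is a polynomial in the square of the remaining side and has
   arbitrarily large roots. *)
have G0 : G = 0.
  apply: unbounded_roots => M.
  have a_gt0 i : 0 < a i by rewrite ltr0n; case: (xc (lift ord0 i)).
  have [v [j [cyc sides big]]] := hex a M a_gt0.
  pose y i := side_length v (lift j i) ^+ 2.
  exists (y ord0) => //; rewrite -evG //.
  pose ev6 := ev 6 (fun i => if unlift ord0 i is Some k then side_length v (lift j k) ^+ 2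
                else 16 * signed_area v ^+ 2).
  have ev6E W : ev6 W = (map_poly (ev 5 y) (in_first W)).[ev6 'X_ord0].
    by apply: rmorph_in_first => i; rewrite !evX liftK.
  have P0 : ev6 P = 0 by apply: vP.
  have Q0' : ev6 Q = 0 by apply: vQ.
  have Tz : (map_poly (ev 5 y) T).[ev6 'X_ord0] = 0.
    move: Q0'; rewrite ev6E Eq eq_q rmorphD rmorphM hornerD hornerM -Ep -ev6E P0.
    by rewrite mulr0 add0r.
  rewrite -[LHS](hornerC _ (ev6 'X_ord0)) -map_polyC eg rmorphD !rmorphM.
  by rewrite hornerD !hornerM -Ep -ev6E P0 Tz !mulr0 addr0.
have : ev 5 (fun i => (x i)%:R) g = (ex g)%:~R.
  rewrite -[RHS]/((intr \o ex) g); apply: mpoly_int_morph_eq => i.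
  by rewrite evX /= mevalXU rmorph_nat.
rewrite evG // G0 horner0 => /esym/eqP.
by rewrite intr_eq0 (negbTE gx).
Qed.

(** * Hexagons with four prescribed sides and a large fifth *)

Definition rot (R : pzRingType) (c s : R) (p : R * R) : R * R :=
  (c * p.1 - s * p.2, s * p.1 + c * p.2).

Definition norm2 (R : pzRingType) (p : R * R) : R := p.1 ^+ 2 + p.2 ^+ 2.

Lemma norm2_rot (R : comPzRingType) (c s : R) p :
  c ^+ 2 + s ^+ 2 = 1 -> norm2 (rot c s p) = norm2 p.
Proof.
move=> e; transitivity ((c ^+ 2 + s ^+ 2) * norm2 p); last by rewrite e mul1r.
by rewrite /norm2 /rot /=; ring.
Qed.

Lemma dist_rot (R : realType) (c s : R) p :
  c ^+ 2 + s ^+ 2 = 1 -> dist (rot c s p) p ^+ 2 = (2 - 2 * c) * norm2 p.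
Proof.
move=> e; rewrite dist_sqr.
transitivity ((c ^+ 2 + s ^+ 2 + 1 - 2 * c) * norm2 p).
  by rewrite /norm2 /rot /=; ring.
by rewrite e; ring.
Qed.

(** On a large circle, four short chords are laid off from one end [p5] of a diameter; the endpoint
    [p1] stays near [p5], hence far from the other end [p0]. *)
Lemma exists_hexagons (R : realType) : hexagons R.
Proof.
move=> a M a_gt0.
pose i0 : 'I_4 := inord 0; pose i1 : 'I_4 := inord 1.
pose i2 : 'I_4 := inord 2; pose i3 : 'I_4 := inord 3.
have i_cases (i : 'I_4) : [\/ i = i0, i = i1, i = i2 | i = i3].
  by case: i => [[|[|[|[|m]]]] lt] //; [constructor 1|constructor 2|constructor 3|constructor 4];
    apply: val_inj; rewrite /= inordK.
(* The squared diameter, large enough for every chord to fit and for [D] minus four times the sum of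
   the squared chords to exceed [M]. *)
pose D := `|M| + 4 * (a i0 + a i1 + a i2 + a i3) + 1.
have [a0 a1 a2 a3] : [/\ 0 < a i0, 0 < a i1, 0 < a i2 & 0 < a i3] by [].
have M0 : 0 <= `|M| by apply: normr_ge0.
have MM : M <= `|M| by apply: ler_norm.
have D_gt0 : 0 < D by rewrite /D; lra.
have aD i : a i <= D by rewrite /D; case: (i_cases i) => ->; lra.
pose r := Num.sqrt D / 2.
have r_gt0 : 0 < r by rewrite divr_gt0 // sqrtr_gt0.
have r2 : r ^+ 2 = D / 4 by rewrite expr_div_n sqr_sqrtr ?ltW //; field.
(* Cosine of the central angle: a chord has squared length [2 r^2 (1 - c) = D (1 - c) / 2]. *)
pose c i := 1 - 2 * a i / D; pose s i := Num.sqrt (1 - c i ^+ 2).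
have cs i : c i ^+ 2 + s i ^+ 2 = 1.
  rewrite sqr_sqrtr; first by ring.
  have q0 : 0 <= a i / D by rewrite divr_ge0 // ltW.
  have q1 : a i / D <= 1 by rewrite ler_pdivrMr ?mul1r.
  rewrite /c -mulrA; nra.
pose p5 := (r, 0 : R); pose p4 := rot (c i3) (s i3) p5.
pose p3 := rot (c i2) (s i2) p4; pose p2 := rot (c i1) (s i1) p3.
pose p1 := rot (c i0) (s i0) p2; pose p0 := (- r, 0 : R).
have n5 : norm2 p5 = r ^+ 2 by rewrite /norm2 /p5 /=; ring.
have n4 : norm2 p4 = r ^+ 2 by rewrite norm2_rot.
have n3 : norm2 p3 = r ^+ 2 by rewrite norm2_rot.
have n2 : norm2 p2 = r ^+ 2 by rewrite norm2_rot.
have n1 : norm2 p1 = r ^+ 2 by rewrite norm2_rot.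
have n0 : norm2 p0 = r ^+ 2 by rewrite /norm2 /p0 /=; ring.
have step i q : norm2 q = r ^+ 2 -> dist (rot (c i) (s i) q) q ^+ 2 = a i.
  move=> nq; rewrite dist_rot // nq r2 /c; field.
  by rewrite gt_eqF.
have s1 : dist p1 p2 ^+ 2 = a i0 by apply: step.
have s2 : dist p2 p3 ^+ 2 = a i1 by apply: step.
have s3 : dist p3 p4 ^+ 2 = a i2 by apply: step.
have s4 : dist p4 p5 ^+ 2 = a i3 by apply: step.
have big : M < dist p0 p1 ^+ 2.
  clearbody p4 p3 p2 p1; move: s1 s2 s3 s4 n1; rewrite !dist_sqr /norm2 /p5 /p0 /=.
  move: p1 p2 p3 p4 r r2 {r_gt0 n0 n2 n3 n4 n5 step p5 p0}.
  move=> [x1 y1] [x2 y2] [x3 y3] [x4 y4] r r2 /= e1 e2 e3 e4 n1.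
  have cauchy (u v w t : R) : (u + v + w + t) ^+ 2 <= 4 * (u ^+ 2 + v ^+ 2 + w ^+ 2 + t ^+ 2).
    rewrite -subr_ge0 (_ : _ - _ = (u - v) ^+ 2 + (u - w) ^+ 2 + (u - t) ^+ 2 + (v - w) ^+ 2
      + (v - t) ^+ 2 + (w - t) ^+ 2); last by ring.
    by rewrite !addr_ge0 ?sqr_ge0.
  have cx := cauchy (x1 - x2) (x2 - x3) (x3 - x4) (x4 - r).
  have cy := cauchy (y1 - y2) (y2 - y3) (y3 - y4) (y4 - 0).
  (* Cauchy-Schwarz, applied in each coordinate to the four steps from [p1] to [p5]. *)
  have far : (x1 - r) ^+ 2 + y1 ^+ 2 <= 4 * (a i0 + a i1 + a i2 + a i3).
    rewrite -e1 -e2 -e3 -e4.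
    have -> : (x1 - r) ^+ 2 + y1 ^+ 2 = (x1 - x2 + (x2 - x3) + (x3 - x4) + (x4 - r)) ^+ 2
       + (y1 - y2 + (y2 - y3) + (y3 - y4) + (y4 - 0)) ^+ 2 by ring.
    lra.
  (* Parallelogram law: the squared distances from [p1] to the antipodes [p0] and [p5] add up to
     [D]. *)
  have -> : (- r - x1) ^+ 2 + (0 - y1) ^+ 2 =
     2 * r ^+ 2 + 2 * (x1 ^+ 2 + y1 ^+ 2) - ((x1 - r) ^+ 2 + y1 ^+ 2) by ring.
  by rewrite n1 r2 /D in far *; lra.
pose v (i : 'I_6) := nth p0 [:: p0; p1; p2; p3; p4; p5] i.
exists v, ord_max; split.
- exists (0, 0), r; split=> //.
    have dr q : norm2 q = r ^+ 2 -> dist q (0, 0) = r.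
      by move=> nq; rewrite /dist !subr0 -/(norm2 q) nq sqrtr_sqr gtr0_norm.
    by case=> [[|[|[|[|[|[|m]]]]]] lt] //; apply: dr.
  rewrite -[(0, 0)]/(0 : R * R) mul0rn /v /=.
  by apply/eqP; rewrite -[p5 + p0]/(r - r, 0 + 0 : R) subrr addr0.
- by move=> k; case: (i_cases k) => ->; rewrite /side_length /v /= ?inordK.
- by [].
Qed.

(** * Return to u_2, r^2 and the rational polynomials *)

Definition qsym (k : nat) : Qsig := 'X_(inord k).
Definition qx0 : Qsig := - 4 * 'X_ord0.

Lemma mul4_t2 : 4 * t2 = fT2 qx0%:P (fun k => (qsym k)%:P) (4 * r2).
Proof.
(* Division is by a unit of a ring only, so it is cancelled first and the quotient is then treated
   as an atom. *)
have e : t1 ^+ 2 / 4 * 4 = t1 ^+ 2 by rewrite divrK // (unit_nat 3).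
transitivity (- 4 * sigma 2 + t1 ^+ 2 / 4 * 4 + 16 * r2 * t1 - 4 * u2).
  by rewrite /t2; move: (t1 ^+ 2 / 4) => y; ring.
rewrite e /fT2 /t1 /qx0 /u2 /sigma /qsym polyCM polyCN polyC_natr.
by ring.
Qed.

Lemma mul8_t3 : 8 * t3 = fT3 qx0%:P (fun k => (qsym k)%:P) (4 * r2).
Proof.
have e : t1 * t2 / 2 * 2 = t1 * t2 by rewrite divrK // (unit_nat 1).
rewrite /fT3 -mul4_t2.
transitivity (8 * sigma 3 + 4 * (t1 * t2 / 2 * 2) - 8 * r2 * (t1 ^+ 2 - 4 * t2)).
  by rewrite /t3; move: (t1 * t2 / 2) => y; ring.
by rewrite e; move: t2 => y; rewrite /t1 /sigma /qsym; ring.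
Qed.

Lemma mul64_t4 : 64 * t4 = fT4 qx0%:P (fun k => (qsym k)%:P) (4 * r2).
Proof.
have e : t2 ^+ 2 / 4 * 4 = t2 ^+ 2 by rewrite divrK // (unit_nat 3).
rewrite /fT4 -mul4_t2.
transitivity (- 64 * sigma 4 + 16 * (t2 ^+ 2 / 4 * 4) - 128 * r2 * t1 * t2).
  by rewrite /t4; move: (t2 ^+ 2 / 4) => y; ring.
by rewrite e; move: t2 => y; rewrite /t1 /sigma /qsym; ring.
Qed.

Lemma comp_pA (S : comNzRingType) (x0 c : S) s :
  pA x0 s \Po (c *: 'X) = fA x0%:P (fun k => (s k)%:P) (c%:P * 'X).
Proof.
rewrite -[LHS]/(comp_poly (c *: 'X) _) /pA fA_morph /= !comp_polyC comp_polyX.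
by rewrite -mul_polyC; apply: eq_fA => k _ /=; rewrite comp_polyC.
Qed.

Lemma comp_pB (S : comNzRingType) (x0 c : S) s :
  pB x0 s \Po (c *: 'X) = fB x0%:P (fun k => (s k)%:P) (c%:P * 'X).
Proof.
rewrite -[LHS]/(comp_poly (c *: 'X) _) /pB fB_morph /= !comp_polyC comp_polyX.
by rewrite -mul_polyC; apply: eq_fB => k _ /=; rewrite comp_polyC.
Qed.

Definition q64 : Qsig := (64%:R^-1)%:MP.

Lemma q64K (p : {poly Qsig}) : p = q64 *: (64 * p).
Proof.
rewrite -mul_polyC mulrA -[64]polyC_natr -polyCM -mpolyC_nat /q64 -mpolyCM.
by rewrite mulVf // mpolyC1 mul1r.
Qed.

Lemma eliminants :
  t3 ^+ 2 - 4 * u2 * t4 = q64 *: (pA qx0 qsym \Po (4%:R *: 'X)) /\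
  t5 = q64 *: (pB qx0 qsym \Po (4%:R *: 'X)).
Proof.
rewrite comp_pA comp_pB polyC_natr -/r2 /fA /fB -mul8_t3 -mul64_t4 -mul4_t2.
split; rewrite [LHS]q64K; congr (_ *: _).
  rewrite /qx0 /u2 polyCM polyCN polyC_natr; move: t3 t4 => y z; ring.
by rewrite /t5 /sigma /qsym; move: t2 => y; ring.
Qed.

(** The scalars 1/64 on polynomials of degrees 6 and 5 contribute 64^-(5+6), and the passage from D
    to 4 r^2 contributes 4^(6*5). *)
Lemma eliminant_resultant :
  resultant (t3 ^+ 2 - 4 * u2 * t4) t5 = (64^-1 ^+ 11 * 4 ^+ 30) *: heron_res qx0 qsym.
Proof.
have nz k : k.+1%:R != 0 :> Qsig by rewrite -mpolyC_nat mpolyC_eq0 pnatr_eq0.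
have c0 : q64 != 0 by rewrite mpolyC_eq0.
have [-> ->] := eliminants.
have sz (p : {poly Qsig}) : size (q64 *: (p \Po (4%:R *: 'X))) = size p.
  by rewrite size_scale // size_comp_poly2 // size_scale ?size_polyX // (nz 3%N).
rewrite (resultant_sres (m := 6) (n := 5)); rewrite ?sz ?size_pA ?size_pB ?nz //.
have w0 k : \prod_(i < k) (4%:R ^+ i : Qsig) != 0.
  by apply/prodf_neq0 => i _; rewrite expf_neq0 // (nz 3%N).
have := sres_scale_eq 6 5 (pA qx0 qsym) (pB qx0 qsym) q64 q64 4%:R.
move/(mulfI (mulf_neq0 (w0 5%N) (w0 6%N))) => ->.
rewrite -/(heron_res qx0 qsym) -mul_mpolyC -exprD /q64 -mpolyC_nat -[(5 + 6)%N]/11%N.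
by move: 64^-1 4%:R => a b; rewrite rmorphM !rmorphXn.
Qed.

Theorem mainTheorem8 (R : realType) :
  subst_u2 (alpha' R 5) =
  subst_sigma (4^-1 *: resultant (t3 ^+ 2 - 4 * u2 * t4) t5).
Proof.
have [P res_P] := heron_res_int_div.
have vP := @vanishes_hexagon R P res_P.
have aP : is_alpha' R P.
  split=> //; [exact: alpha_irreducible | exact: monic_in_first | exact: alpha_homog].
have -> : alpha' R 5 = P.
  apply: xget_unique => [|Q [aQ _]].
    by split=> // Q aQ; apply/esym; exact: (alpha_unique (@exists_hexagons R) res_P vP aQ).
  exact: (alpha_unique (@exists_hexagons R) res_P vP aQ).
(* Both substitutions are regarded as ring morphisms, so they commute with [heron_res]. *)
pose theta : {rmorphism {mpoly int[6]} -> {mpoly rat[6]}} :=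
  comp_mpoly [tuple if i == ord0 then - 4 *: 'X_ord0 else 'X_i | i < 6] \o
  map_mpoly (intr : int -> rat).
have thetaX i : theta 'X_i = if i == ord0 then - 4 *: 'X_ord0 else 'X_i.
  by rewrite /theta /= map_mpolyX comp_mpolyXU nth_mktuple.
pose psi : {rmorphism Qsig -> {mpoly rat[6]}} :=
  comp_mpoly [tuple if unlift ord0 i is Some k
           then mesym 5 rat k.+1 \mPo [tuple 'X_(lift ord0 l) | l < 5]
           else 'X_ord0 | i < 6].
have psiX i : psi 'X_i = if unlift ord0 i is Some k
           then mesym 5 rat k.+1 \mPo [tuple 'X_(lift ord0 l) | l < 5]
           else 'X_ord0.
  by rewrite /psi /= comp_mpolyXU nth_mktuple.
have theta_res : theta heron_res_int = psi (heron_res qx0 qsym).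
  transitivity (heron_res (theta 'X_ord0) (theta \o elsym (@xside int) 5)); first exact: heron_res_morph.
  transitivity (heron_res (psi qx0) (psi \o qsym)); last exact/esym/heron_res_morph.
  have -> : theta 'X_ord0 = psi qx0.
    rewrite thetaX eqxx /qx0 rmorphM psiX unlift_none -mul_mpolyC; congr (_ * _).
    by rewrite !rmorphN !rmorph_nat.
  apply: eq_heron_res.
  move=> k /andP[k0 k5].
  case: k k0 k5 => [k0|k _] k5.
    by exfalso; rewrite ltnn in k0.
  transitivity (elsym (theta \o @xside int) 5 k.+1); first exact: elsym_morph.
  rewrite -[RHS]/(psi _) psiX (inord_lift (Ordinal k5)) liftK.
  rewrite (rmorph_mesym (y := @xside rat)) => [|i].
    apply: eq_elsym => i i5; rewrite /= /xside (inord_lift (Ordinal i5)).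
    by rewrite -[LHS]/(theta _) thetaX.
  by rewrite /= comp_mpolyXU nth_mktuple /xside inord_lift.
rewrite eliminant_resultant scalerA /subst_sigma comp_mpolyZ.
rewrite -[heron_res _ _ \mPo _]/(psi _) -theta_res res_P rmorphM rmorph_nat.
rewrite -[LHS]/(theta P) -mpolyC_nat mul_mpolyC scalerA.
(* With x = 4 this collects the outer 1/4, the factor of [eliminant_resultant] and 256 = 4^4: the
   exponents -1 - 33 + 30 + 4 sum to 0. *)
have e (x : rat) : x != 0 -> x^-1 * ((x ^+ 3)^-1 ^+ 11 * x ^+ 30) * x ^+ 4 = 1.
  by move=> x0; field.
have e64 : 64 = 4 ^+ 3 :> rat by ring.
have e256 : 256 = 4 ^+ 4 :> rat by ring.
have nz4 : 4 != 0 :> rat by rewrite pnatr_eq0.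
rewrite e64 e256 e; last exact: nz4.
exact/esym/scale1r.
Qed.
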